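(* Let $\mathcal X$ be a hyperelliptic curve of genus $g\ge 2$ over $\mathbb F_q$ given by an imaginary model $y^2+h(x)y=f(x)$ with unique point at infinity $P_\infty$. Let $A$ be an $\mathbb F_q$-rational divisor on $\mathcal X$ of degree $g$, and let $(u_A,v_A)$ be the reduced Mumford representative of the class $[A-gP_\infty]\in J(\mathcal X)$. Then $A$ is non-special if and only if $\deg u_A\in\{g-1,g\}$; equivalently, $A$ is non-special if and only if $\deg u_A\ge g-1$.
   Context: $\mathbb F_q$ is a finite field, of any characteristic. $\mathcal X$ is the smooth projective curve of genus $g\ge2$ with affine equation $y^2+h(x)y=f(x)$, where $h,f\in\mathbb F_q[x]$, $f$ is monic of degree $2g+1$, $\deg h\le g$, and the affine curve is nonsingular over $\overline{\mathbb F}_q$; it has a single point at infinity $P_\infty$, which is $\mathbb F_q$-rational. $J(\mathcal X)=\mathrm{Pic}^0(\mathcal X)$ is the group of degree-zero $\mathbb F_q$-rational divisors modulo linear equivalence. A Mumford pair is $(u,v)\in\mathbb F_q[x]^2$ with $u$ monic, $\deg v<\deg u$ ($v=0$ if $u=1$), and $u\mid v^2+hv-f$. It determines the effective affine $\mathbb F_q$-rational divisor $D_{(u,v)}=\sum_{\xi}m_\xi\,(\xi,v(\xi))$, where $\xi$ runs over the roots of $u$ in $\overline{\mathbb F}_q$ and $m_\xi$ is the multiplicity of $\xi$ in $u$; its degree is $\deg u$. The pair is reduced if $\deg u\le g$. Every class in $J(\mathcal X)$ equals $[D_{(u,v)}-(\deg u)P_\infty]$ for a unique reduced Mumford pair $(u,v)$,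 called the reduced Mumford representative of the class. For a divisor $G$, $\ell(G)=\dim_{\mathbb F_q}\mathcal L(G)$ is the dimension of its Riemann-Roch space; $G$ is non-special if $\ell(K-G)=0$, where $K$ is a canonical divisor, equivalently $\ell(G)=\deg G+1-g$. *)

(* Defs.v *)
From HB Require Import structures.
From mathcomp Require Import all_boot all_order all_algebra all_field.
From mathcomp Require Import ring zify.
From mathcomp Require Export polyXY.
From mathcomp Require Export freeg.

Set Implicit Arguments.
Unset Strict Implicit.
Unset Printing Implicit Defensive.

Import Order.TTheory GRing.Theory Num.Theory.
Local Open Scope ring_scope.

(* y^2 + h(x) y = f(x); nonsingularity is [nonsingular] below, because it      *)
(* refers to the algebraic closure.                                            *)
Record imaginary_model (F : finFieldType) := ImaginaryModel {
  genus : nat;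
  hpol : {poly F};
  fpol : {poly F};
  genus_ge2 : (2 <= genus)%N;
  fpol_monic : fpol \is monic;
  size_fpol : size fpol = (2 * genus).+2;
  size_hpol : (size hpol <= genus.+1)%N }.

Lemma fracE (R : idomainType) (z : {fraction R}) :
  exists a b : R, b != 0 /\ z = tofrac a / tofrac b.
Proof.
elim/quotW: z => r; exists r.1, r.2; split; first exact: denom_ratioP.
apply: (canRL (mulfK _)); first by rewrite tofrac_eq0 denom_ratioP.
rewrite !piE; apply/eqP; rewrite FracField.equivf_def.
have d0 := denom_ratioP r.
by rewrite !numden_Ratio ?mulf_neq0 ?oner_eq0 // !mulr1 mulrC.
Qed.

Lemma clear_denom (K : fieldType) (A B h f : K) : B != 0 ->
  (A / B) ^+ 2 + h * (A / B) - f = 0 -> A ^+ 2 + h * A * B - f * B ^+ 2 = 0.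
Proof.
move=> B0 /(congr1 ( *%R^~ (B ^+ 2))); rewrite mul0r => <-.
by field.
Qed.

Section FunctionField.
Variables (F : finFieldType) (C : imaginary_model F).

Definition curve_poly : {poly {fraction {poly F}}} :=
  'X^2 + (tofrac (hpol C))%:P * 'X - (tofrac (fpol C))%:P.

Let size_low :
  (size ((tofrac (hpol C))%:P * 'X - (tofrac (fpol C))%:P)%R < 3)%N.
Proof.
rewrite -polyCN -cons_poly_def size_cons_poly; case: ifP => // _.
by rewrite !ltnS size_polyC_leq1.
Qed.

Lemma curve_poly_monic : curve_poly \is monic.
Proof.
by rewrite /curve_poly -addrA monicE lead_coefDl ?lead_coefXn // size_polyXn.
Qed.

Let no_root (a b : {poly F}) : b != 0 ->
  a ^+ 2 + hpol C * a * b <> fpol C * b ^+ 2.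
Proof.
have sz2 (p : {poly F}) : p != 0 -> size (p ^+ 2) = (2 * (size p).-1).+1.
  move=> p0; rewrite expr2 size_mul //; move: p0; rewrite -size_poly_gt0; move: (size p); lia.
move=> b0 E; have f0 : fpol C != 0 by rewrite monic_neq0 ?fpol_monic.
have a0 : a != 0.
  apply: contra_eq_neq E => ->; rewrite expr0n mulr0 mul0r addr0 eq_sym.
  by rewrite mulf_neq0 ?expf_neq0.
have := size_mul f0 (expf_neq0 2 b0); rewrite -E sz2 // size_fpol.
have := size_polyMleq (hpol C * a) b; have := size_polyMleq (hpol C) a.
have := size_hpol C; have := size_polyD (a ^+ 2) (hpol C * a * b).
have := @size_polyDl _ (a ^+ 2) (hpol C * a * b); rewrite sz2 //.
move: a0 b0; rewrite -!size_poly_gt0.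
set s1 := size a; set s2 := size b; set s3 := size (hpol C).
set s4 := size (hpol C * a)%R; set s5 := size (hpol C * a * b)%R.
set s6 := size (a ^+ 2 + _)%R.
by move: s1 s2 s3 s4 s5 s6; lia.
Qed.

Lemma curve_poly_irreducible : monic_irreducible_poly curve_poly.
Proof.
split; last exact: curve_poly_monic.
apply: cubic_irreducible.
  by rewrite /curve_poly -addrA size_polyDl size_polyXn.
move=> r; apply/negP; rewrite rootE /curve_poly !hornerE => /eqP.
have [a [b [b0 ->]]] := fracE r; move=> E; apply: (no_root (a := a) b0).
apply/eqP; rewrite -tofrac_eq !(rmorphD, rmorphM, rmorphXn) /= -subr_eq0.
have {}b0 : tofrac b != 0 by rewrite tofrac_eq0.
by apply/eqP; apply: clear_denom E.
Qed.

(* F(X) = F(x)[y] / (y^2 + h y - f) *)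
Definition function_field := {poly %/ curve_poly with curve_poly_irreducible}.
HB.instance Definition _ := GRing.Field.on function_field.
HB.instance Definition _ := GRing.UnitAlgebra.on function_field.

Definition ratfun (r : {fraction {poly F}}) : function_field := r%:A.
Definition cst (c : F) : function_field := ratfun (tofrac c%:P).
Definition xfun : function_field := ratfun (tofrac 'X).
Definition yfun : function_field := in_qpoly curve_poly 'X.

Definition derivation (d : function_field -> function_field) : Prop :=
  [/\ forall c, d (cst c) = 0,
      forall a b, d (a + b) = d a + d b &
      forall a b, d (a * b) = d a * b + a * d b].

End FunctionField.

Section Geometry.
(* In all uses, K is an algebraic closure of F via iota: [integralRange iota]. *)
Variables (F : finFieldType) (K : closedFieldType) (iota : {rmorphism F -> K}).
Variable C : imaginary_model F.

Local Notation E := (function_field C).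
Local Notation "p ^K" := (map_poly iota p) (at level 2, format "p ^K").

Definition on_curve (P : K * K) : bool :=
  P.2 ^+ 2 + (hpol C)^K.[P.1] * P.2 == (fpol C)^K.[P.1].

Definition affine_point := {P : K * K | on_curve P}.
HB.instance Definition _ := Choice.on affine_point.

Definition nonsingular : Prop := forall P : affine_point,
  let: (a, b) := val P in
  ~ (2%:R * b + (hpol C)^K.[a] = 0 /\
     ((hpol C)^`())^K.[a] * b - ((fpol C)^`())^K.[a] = 0).

(* Geometric points; [None] is the point at infinity. *)
Definition point := option affine_point.
HB.instance Definition _ := Choice.on point.
Definition Pinf : point := None.

Local Notation divisor := {freeg point}.

(* F-rational = invariant under the Frobenius of K / F, which fixes [Pinf]. *)
Definition rational_divisor (D : divisor) : Prop :=
  forall P Q : affine_point,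
    val Q = ((val P).1 ^+ #|F|, (val P).2 ^+ #|F|) ->
    coeff (Some Q) D = coeff (Some P) D.

(* The smooth projective model is glued from the chart (x, y) and the chart at *)
(* infinity (z, w) = (1/x, y/x^(g+1)), where w^2 + z^(g+1) h(1/z) w =          *)
(* z^(2g+2) f(1/z); [Pinf] is the point (z, w) = (0, 0).                       *)
Definition chart (P : point) : E * E :=
  if P is Some _ then (xfun C, yfun C)
  else ((xfun C)^-1, yfun C / xfun C ^+ (genus C).+1).
Definition chart_coords (P : point) : K * K :=
  if P is Some Q then val Q else (0, 0).

Definition chart_fun (P : point) (n : {poly {poly F}}) : E :=
  (map_poly (map_poly (@cst F C)) n).[(chart P).1, (chart P).2].
Definition chart_val (P : point) (n : {poly {poly F}}) : K :=
  (map_poly (map_poly iota) n).[(chart_coords P).1, (chart_coords P).2].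

(* The local ring of the closed point of X / F below P, its maximal ideal and  *)
(* its units. As F is perfect, X_K -> X is unramified, so the order computed   *)
(* in this ring is the order of vanishing at P on X_K.                         *)
Definition local_ring (P : point) (phi : E) : Prop :=
  exists n d, chart_val P d != 0 /\ phi = chart_fun P n / chart_fun P d.
Definition local_max (P : point) (phi : E) : Prop :=
  exists n d, [/\ chart_val P n = 0, chart_val P d != 0 &
                  phi = chart_fun P n / chart_fun P d].
Definition local_unit (P : point) (phi : E) : Prop :=
  exists n d, [/\ chart_val P n != 0, chart_val P d != 0 &
                  phi = chart_fun P n / chart_fun P d].

Definition uniformizer (P : point) (t : E) : Prop :=
  [/\ t != 0, local_max P t & forall s, local_max P s -> local_ring P (s / t)].

(* ord_P(phi) = k; never holds for phi = 0 *)
Definition has_ord (P : point) (phi : E) (k : int) : Prop :=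
  exists2 t, uniformizer P t & local_unit P (phi / t ^ k).

Definition lin_equiv (D1 D2 : divisor) : Prop :=
  exists phi : E, forall P, has_ord P phi (coeff P (D1 - D2)).

Definition RR_space (G : divisor) (phi : E) : Prop :=
  phi = 0 \/ forall P, exists2 k, has_ord P phi k & - coeff P G <= k.

Definition has_ell (G : divisor) (n : nat) : Prop :=
  exists e : 'I_n -> E,
    (forall c : 'I_n -> F, \sum_i cst C (c i) * e i = 0 -> forall i, c i = 0) /\
    (forall phi, RR_space G phi <->
       exists c : 'I_n -> F, phi = \sum_i cst C (c i) * e i).

(* W = div(omega) for the nonzero differential omega = phi dpsi of F(X) / F.   *)
(* The derivations of F(X) / F form a line over F(X), so for any nonzero one,  *)
(* d, we have dpsi / dt = d psi / d t, and ord_P(omega) = ord_P(phi dpsi/dt).  *)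
Definition canonical_divisor (W : divisor) : Prop :=
  exists (d : E -> E) (phi psi : E),
    [/\ derivation d, phi * d psi != 0 &
        forall P t, uniformizer P t ->
          has_ord P (phi * d psi / d t) (coeff P W)].

Definition non_special (G : divisor) : Prop :=
  exists2 W, canonical_divisor W & has_ell (W - G) 0.

Definition pdeg (u : {poly F}) : nat := (size u).-1.

Definition mumford_pair (u v : {poly F}) : Prop :=
  [/\ u \is monic, (size v < size u)%N &
      u %| v ^+ 2 + hpol C * v - fpol C].

Definition reduced_mumford_pair (u v : {poly F}) : Prop :=
  mumford_pair u v /\ (pdeg u <= genus C)%N.

Definition geom_roots (u : {poly F}) : seq K :=
  sval (closed_field_poly_normal u^K).

Definition affine_div (P : K * K) : divisor :=
  if insub P : option affine_point is Some Q then << Some Q >> else 0.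

(* [geom_roots] lists the roots with multiplicity. For a Mumford pair every    *)
(* (xi, v(xi)) lies on the curve ([mumford_on_curve]), so no term is dropped.  *)
Definition mumford_div (u v : {poly F}) : divisor :=
  \sum_(xi <- geom_roots u) affine_div (xi, v^K.[xi]).

Lemma mumford_on_curve u v xi :
  mumford_pair u v -> xi \in geom_roots u -> on_curve (xi, v^K.[xi]).
Proof.
case=> u_monic _ /dvdpP [q e]; rewrite /geom_roots.
case: closed_field_poly_normal => r /= def_u xi_r.
have /rootP u_xi : root u^K xi.
  by rewrite def_u rootZ ?root_prod_XsubC // lead_coef_map fmorph_eq0
     (monicP u_monic) oner_eq0.
rewrite /on_curve /= -subr_eq0.
have /(congr1 (fun p => p^K.[xi])) := e.
rewrite !(rmorphD, rmorphB, rmorphM, rmorphXn, rmorphN) /= !hornerE.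
by rewrite u_xi mulr0 => ->.
Qed.

End Geometry.

Arguments Pinf {F K iota C}.

(* Main.v *)
From HB Require Import structures.
Require Import Defs.
From mathcomp Require Import all_boot all_order all_algebra all_field.
From mathcomp Require Import ring zify.

(* Let [d = deg uA]. Since [A] is equivalent to [D_u + (g - d) Pinf] and the    *)
(* differential [dx / (2 y + h)] has divisor [(2 g - 2) Pinf], [A] is           *)
(* non-special iff [L((g - 2 + d) Pinf - D_u) = 0]. A function regular on the   *)
(* affine curve is [a(x) + b(x) y]; at [Pinf] its two terms have poles of even  *)
(* and odd order, and a pole of order at most [g - 2 + d <= 2 g - 2] forces     *)
(* [b = 0]. As the curve is smooth, [u] is separable at its ramification        *)
(* points, so [a] vanishes along [D_u] iff [u] divides [a]. Hence the space is  *)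
(* nonzero iff it contains [u], that is iff [2 d <= g - 2 + d].                 *)
(* Both charts of the curve have the shape [Y^2 + h(X) Y = f(X)] of a plane     *)
(* curve smooth at the points considered, so the same computation yields local  *)
(* parameters, and the order of the differential above, in both.                *)

Set Implicit Arguments.
Unset Strict Implicit.
Unset Printing Implicit Defensive.

Import Order.TTheory GRing.Theory Num.Theory.
Local Open Scope ring_scope.

(** * Places and orders *)

(** Write [d = pdeg uA] and let [D_u] be the divisor of the pair. A canonical divisor is
    [(2 g - 2) Pinf] ([canonical_Pinf]), any other one differs from it by the divisor of a function
    ([canonical_ord]), and [classA] compares [A] with [D_u + (g - d) Pinf]. Multiplication by the
    functions involved identifies [L(W - A)] with the functions [psi] whose divisor is at least
    [D_u - (g - 2 + d) Pinf].

    Such a [psi] is regular on the affine curve, so it is [a(x) + b(x) y] ([regular_everywhere]).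
    Its pole at [Pinf] is too small for a term in [y] ([infinity_ord_lin]), and vanishing along
    [D_u] means that [u] divides [a] ([mumford_dvdp]). If [d >= g - 1], then [2 d > g - 2 + d]
    leaves only [psi = 0] ([non_special_of_large_degree]); if [d <= g - 2], then [psi = u] is a
    nonzero solution ([special_of_small_degree]).

    Most of the work is local: a uniformizer, the existence of orders, and the order of a
    differential at each point ([chart_unif_ord], [chart_ord_ex], [chart_der_unit]). It is done for
    an abstract chart and used for both charts. *)

Section Place.
Variables (E K : fieldType) (O : E -> K -> Prop).

(* [O] is the graph of the residue map of a valuation ring. *)
Record place : Prop := Place {
  place_fun : forall x v w, O x v -> O x w -> v = w;
  place1 : O 1 1;
  placeB : forall x y v w, O x v -> O y w -> O (x - y) (v - w);
  placeM : forall x y v w, O x v -> O y w -> O (x * y) (v * w);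
  placeV : forall x v, O x v -> v != 0 -> O x^-1 v^-1 }.

Definition integral x := exists v, O x v.
Definition punit x := exists2 v, v != 0 & O x v.
Definition punif t := [/\ t != 0, O t 0 & forall s, O s 0 -> integral (s / t)].
Definition pord x (k : int) := exists2 t, punif t & punit (x / t ^ k).

Hypothesis PO : place.

Lemma place0 : O 0 0.
Proof. by have := placeB PO (place1 PO) (place1 PO); rewrite !subrr. Qed.

Lemma placeN x v : O x v -> O (- x) (- v).
Proof. by move=> /(placeB PO place0); rewrite !sub0r. Qed.

Lemma placeD x y v w : O x v -> O y w -> O (x + y) (v + w).
Proof. by move=> Ox /placeN Oy; have := placeB PO Ox Oy; rewrite !opprK. Qed.

Lemma placeX x v n : O x v -> O (x ^+ n) (v ^+ n).
Proof.
move=> Ox; elim: n => [|n IH]; first by rewrite !expr0; apply: place1.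
by rewrite !exprS; apply: placeM.
Qed.

Lemma integralB x y : integral x -> integral y -> integral (x - y).
Proof. by move=> [v Ox] [w Oy]; exists (v - w); apply: placeB. Qed.

Lemma integralD x y : integral x -> integral y -> integral (x + y).
Proof. by move=> [v Ox] [w Oy]; exists (v + w); apply: placeD. Qed.

Lemma integralM x y : integral x -> integral y -> integral (x * y).
Proof. by move=> [v Ox] [w Oy]; exists (v * w); apply: placeM. Qed.

Lemma place_maxM x y : O x 0 -> integral y -> O (x * y) 0.
Proof. by move=> Ox [w Oy]; have := placeM PO Ox Oy; rewrite mul0r. Qed.

Lemma punit_integral x : punit x -> integral x.
Proof. by move=> [v _ Ox]; exists v. Qed.

Lemma punit_neq0 x : punit x -> x != 0.
Proof.
move=> [v v0 Ox]; apply: contra_neq v0 => x0; move: Ox; rewrite x0 => Ox.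
exact: (place_fun PO Ox place0).
Qed.

Lemma punit_max x : punit x -> O x 0 -> False.
Proof. by move=> [v /eqP v0 Ox] /(place_fun PO Ox). Qed.

Lemma punit1 : punit 1.
Proof. by exists 1; [apply: oner_neq0 | apply: place1]. Qed.

Lemma punitM x y : punit x -> punit y -> punit (x * y).
Proof.
by move=> [v v0 Ox] [w w0 Oy]; exists (v * w); [rewrite mulf_neq0 | apply: placeM].
Qed.

Lemma punitV x : punit x -> punit x^-1.
Proof. by move=> [v v0 Ox]; exists v^-1; [rewrite invr_eq0 | apply: placeV]. Qed.

Lemma punitN x : punit x -> punit (- x).
Proof. by move=> [v v0 Ox]; exists (- v); [rewrite oppr_eq0 | apply: placeN]. Qed.

Lemma punitXz x (k : int) : punit x -> punit (x ^ k).
Proof.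
move=> ux; have uX n : punit (x ^+ n).
  elim: n => [|n IH]; first by rewrite expr0; apply: punit1.
  by rewrite exprS; apply: punitM.
by case: k => n; [apply: uX | rewrite NegzE -exprnN; apply/punitV/uX].
Qed.

Lemma punitD x y : punit x -> O y 0 -> punit (x + y).
Proof. by move=> [v v0 Ox] Oy; exists v => //; rewrite -[v]addr0; apply: placeD. Qed.

Lemma punif_div t s : punif t -> punif s -> punit (t / s).
Proof.
move=> [t0 Ot It] [s0 Os Is].
have [v Ov] := Is t Ot; have [w Ow] := It s Os.
have := placeM PO Ov Ow; rewrite mulrA divfK // mulfV // => O1.
have e := place_fun PO O1 (place1 PO).
exists v => //; apply: contra_eq_neq e => ->; rewrite mul0r eq_sym.
exact: oner_neq0.
Qed.

(** Two uniformizers differ by a unit ([punif_div]), so the order does not depend on the uniformizer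
    that [pord] provides. *)
Lemma pord_unif t x k : punif t -> pord x k -> punit (x / t ^ k).
Proof.
move=> ut [s us ux]; have [s0 _ _] := us.
have := punitM ux (punitXz k (punif_div us ut)).
by rewrite expfzMl -expfV mulrA divfK ?expfz_neq0.
Qed.

Lemma pord_neq0 x k : pord x k -> x != 0.
Proof.
move=> [t _ /punit_neq0]; apply: contra_neq => ->; exact: mul0r.
Qed.

Lemma pordM x y k l : pord x k -> pord y l -> pord (x * y) (k + l).
Proof.
move=> [t ut ux] /(pord_unif ut) uy; exists t => //; have [t0 _ _] := ut.
by rewrite expfzDr // invfM mulrACA; apply: punitM.
Qed.

Lemma pordV x k : pord x k -> pord x^-1 (- k).
Proof.
move=> [t ut ux]; exists t => //.
by have := punitV ux; rewrite invf_div mulrC -invr_expz invrK.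
Qed.

Lemma pord1 x k : pord x k -> pord 1 0.
Proof.
move=> ox; have := pordM ox (pordV ox).
by rewrite mulfV ?(pord_neq0 ox) // addrN.
Qed.

Lemma pord_div x y k l : pord x k -> pord y l -> pord (x / y) (k - l).
Proof. by move=> ox /pordV; apply: pordM. Qed.

Lemma pordX x k n : pord x k -> pord (x ^+ n) (k * n%:Z).
Proof.
move=> ox; elim: n => [|n IH]; first by rewrite expr0 mulr0; apply: pord1 ox.
by rewrite exprS intS mulrDr mulr1; apply: pordM.
Qed.

Lemma punif_ord t : punif t -> pord t 1.
Proof.
move=> ut; exists t => //; rewrite expr1z mulfV; first exact: punit1.
by case: ut.
Qed.

Lemma punit_ord t x : punif t -> punit x -> pord x 0.
Proof. by move=> ut ux; exists t => //; rewrite expr0z invr1 mulr1. Qed.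

Lemma pord_unit x : pord x 0 -> punit x.
Proof. by case=> t ut; rewrite expr0z invr1 mulr1. Qed.

Lemma pord_ge0 x k : pord x k -> 0 <= k -> integral x.
Proof.
move=> [t [t0 Ot _] /punit_integral ix]; case: k ix => // n ix _.
rewrite -[x](@divfK _ (t ^ n)) ?expfz_neq0 //; apply: integralM => //.
by exists (0 ^+ n); apply: placeX.
Qed.

Lemma pord_gt0 x k : pord x k -> 0 < k -> O x 0.
Proof.
move=> [t [t0 Ot _] /punit_integral ix]; case: k ix => // -[//|n] ix _.
rewrite -[x](@divfK _ (t ^ n.+1)) ?expfz_neq0 // mulrC; apply: place_maxM => //.
by have := placeX n.+1 Ot; rewrite expr0n.
Qed.

Lemma pord_integral x k : pord x k -> integral x -> 0 <= k.
Proof.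
move=> ox ix; rewrite leNgt; apply/negP => k0.
have/pord_gt0 : pord x^-1 (- k) by apply: pordV.
rewrite oppr_gt0 => /(_ k0) Ox; apply: punit_max punit1 _.
by rewrite -(@mulVf _ x) ?(pord_neq0 ox) //; apply: place_maxM.
Qed.

Lemma pord_fun x k l : pord x k -> pord x l -> k = l.
Proof.
move=> ox ox'; have x0 := pord_neq0 ox.
have i1 : integral 1 by exists 1; apply: place1.
have := pord_integral (pord_div ox ox'); have := pord_integral (pord_div ox' ox).
by rewrite mulfV // => /(_ i1) le1 /(_ i1) le2; apply/eqP; lia.
Qed.

Lemma pordD x y k l : pord x k -> pord y l -> k < l -> pord (x + y) k.
Proof.
move=> [t ut ux] oy kl; exists t => //.
have ot : pord (t ^ k) k.
  have [t0 _ _] := ut.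
  by exists t => //; rewrite mulfV ?expfz_neq0 //; apply: punit1.
by rewrite mulrDl; apply: punitD => //; apply: (pord_gt0 (pord_div oy ot)); lia.
Qed.

(** This is the source of existence of orders. If [x] has nonzero residue, its order is 0; otherwise
    [x / t] is still integral and the order of the product drops by 1, so the process stops. *)
Lemma pord_factor t x y k : punif t -> integral x -> integral y ->
  pord (x * y) k -> exists l, pord x l.
Proof.
move=> ut ix iy oxy.
have : 0 <= k by apply: pord_integral oxy _; apply: integralM.
case: k oxy => // n oxy _; elim: n x ix oxy => [|n IH] x [v Ox] oxy.
  have [v0|v0] := eqVneq v 0; last by exists 0; apply: (punit_ord ut); exists v.
  rewrite v0 in Ox; case: (punit_max (pord_unit oxy)).
  exact: place_maxM.
have [v0|v0] := eqVneq v 0; last by exists 0; apply: (punit_ord ut); exists v.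
rewrite v0 in Ox; have [t0 _ /(_ x Ox) ixt] := ut.
have [|l ol] := IH (x / t) ixt.
  rewrite mulrAC (_ : n%:Z = n.+1%:Z - 1); last by rewrite -addn1 PoszD addrK.
  by apply: pord_div => //; apply: punif_ord.
by exists (l + 1); rewrite -[x](divfK t0); apply: pordM (punif_ord ut).
Qed.

End Place.

(** * Elements algebraic over a finite field *)

Section AlgebraicElement.
Variables (F : finFieldType) (K : closedFieldType) (iota : {rmorphism F -> K}).
Local Notation "p ^K" := (map_poly iota p) (at level 2, format "p ^K").

Lemma expf_card_iter (c : F) n : c ^+ (#|F| ^ n) = c.
Proof. by elim: n => [|n IH]; rewrite ?expr1 // expnS exprM expf_card. Qed.

Lemma card_finField_pchar :
  exists p k, [/\ prime p, p \in [pchar F] & #|F| = (p ^ k.+1)%N].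
Proof.
have [p p_pr pF] := finPcharP F; exists p, (logn p #|F|).-1; split=> //.
have := finNzRing_gt1 F; rewrite (card_pprimeChar pF : #|F| = _).
by rewrite pfactorK //; case: logn.
Qed.

Lemma exprD_card (x y : K) n :
  (x + y) ^+ (#|F| ^ n) = x ^+ (#|F| ^ n) + y ^+ (#|F| ^ n).
Proof.
have [p [k [p_pr pF ->]]] := card_finField_pchar; apply: exprDn_pchar.
by rewrite !pnatX pnatE // (fmorph_pchar iota) pF.
Qed.

Lemma horner_card (p : {poly F}) (x : K) n :
  p^K.[x ^+ (#|F| ^ n)] = p^K.[x] ^+ (#|F| ^ n).
Proof.
elim/poly_ind: p => [|p c IH].
  by rewrite rmorph0 !horner0 expr0n -leqn0 leqNgt expn_gt0 (ltnW (finNzRing_gt1 F)).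
by rewrite rmorphD rmorphM /= map_polyX map_polyC /= !hornerE IH exprD_card exprMn
  -rmorphXn expf_card_iter.
Qed.

Lemma expr_card_inj n : injective (fun x : K => x ^+ (#|F| ^ n)).
Proof.
move=> x y /= e; apply/eqP; rewrite -subr_eq0.
have : (x - y) ^+ (#|F| ^ n) = 0.
  by apply: (addIr (y ^+ (#|F| ^ n))); rewrite -exprD_card subrK add0r.
by move/eqP; rewrite expf_eq0 => /andP[].
Qed.

(** The powers [x ^+ (#|F| ^ i)] are all roots of one polynomial over [F], so two of them coincide,
    and the Frobenius is injective. *)
Lemma expr_card_cycle (x : K) : integralOver iota x ->
  exists2 n, (0 < n)%N & x ^+ (#|F| ^ n) = x.
Proof.
case=> p p_mon px.
pose s := [seq x ^+ (#|F| ^ i) | i <- seq.iota 0 (size p)].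
have : ~~ uniq s.
  apply/negP => us; suff: (size s < size p^K)%N.
    by rewrite size_map size_iota size_map_poly ltnn.
  apply: max_poly_roots => //; first by rewrite map_poly_eq0 monic_neq0.
  apply/allP => _ /mapP [i _ ->].
  by rewrite rootE horner_card (rootP px) expr0n -leqn0 leqNgt expn_gt0
    (ltnW (finNzRing_gt1 F)).
case/(uniqPn 0) => i [j []]; rewrite size_map size_iota => ij js.
rewrite !(nth_map 0%N) ?size_iota ?nth_iota ?(ltn_trans ij) // !add0n => e.
exists (j - i)%N; first by rewrite subn_gt0.
by apply: (@expr_card_inj i); rewrite -exprM -expnD subnK // ltnW.
Qed.

Hypothesis K_algebraic : integralRange iota.

(** The minimal polynomial of [a] divides [X^(q^n) - X] for some [n > 0], where [q = #|F|], and the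
    derivative of that polynomial is [-1]. *)
Lemma separable_minpoly (a : K) : exists m : {poly F},
  [/\ m^K.[a] = 0, forall p, p^K.[a] = 0 -> m %| p & (m^`())^K.[a] != 0].
Proof.
have dec : decidable_embedding iota.
  move=> y; have [/existsP ex|/existsP nex] := boolP [exists x, y == iota x].
    by left; case: ex => x /eqP ->; exists x.
  by right=> -[x e]; apply: nex; exists x; apply/eqP.
have [m [m_mon ma m_irr]] := minPoly_decidable_closure dec (K_algebraic a).
have mdvd p : p^K.[a] = 0 -> m %| p.
  move=> pa; rewrite -[_ %| _]negbK -(irreducible_poly_coprime _ m_irr).
  apply/negP; rewrite -(coprimep_map iota) => /coprimep_root /(_ ma).
  by rewrite pa eqxx.
exists m; split=> //; first exact/rootP.
have [n n0 an] := expr_card_cycle (K_algebraic a).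
have /mdvd /dvdpP [s es] : ('X^(#|F| ^ n) - 'X)^K.[a] = 0.
  by rewrite rmorphB /= map_polyXn map_polyX !hornerE an subrr.
have q0 : (#|F| ^ n)%:R = 0 :> F.
  have [p [k [p_pr pF ->]]] := card_finField_pchar.
  by rewrite !natrX (pcharf0 pF) !expr0n; case: (n) n0.
have /(congr1 (fun p => p^K.[a])) := congr1 (@deriv _) es.
rewrite derivB derivXn derivX -mulr_natl -polyC_natr q0 mul0r sub0r derivM.
rewrite rmorphD !rmorphM !hornerE /= (rootP ma) mulr0 add0r rmorphN rmorph1 !hornerE.
move=> e; apply: contra_eq_neq e => ->; rewrite mulr0 oppr_eq0.
exact: oner_neq0.
Qed.

(** The ordinate of a ramification point lies in [F(a)]. This allows a uniformizer [Y - v(X)] with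
    [v] over [F]. *)
Lemma ramified_lift (h f : {poly F}) (a b : K) :
  b ^+ 2 + h^K.[a] * b = f^K.[a] -> 2%:R * b + h^K.[a] = 0 ->
  exists v : {poly F}, v^K.[a] = b.
Proof.
move=> eb ram; have [c2|c2] := eqVneq (2%:R : F) 0.
  have K2 : 2%:R = 0 :> K by rewrite -(rmorph_nat iota) c2 rmorph0.
  move: ram; rewrite K2 mul0r add0r => ha.
  move: eb; rewrite ha mul0r addr0 => eb.
  have [n n0 bn] := expr_card_cycle (K_algebraic b).
  have ev : ~~ odd (#|F| ^ n).
    apply/negP => od.
    have [p [k [p_pr pF Ep]]] := card_finField_pchar.
    have p2 : p = 2%N.
      have := c2; move/eqP; rewrite -(dvdn_pcharf pF) => /(dvdn_leq (isT : 0 < 2)%N).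
      by case: p p_pr {pF Ep} => [|[|[|]]].
    by move: od; rewrite Ep p2 !oddX /= eqn0Ngt n0.
  (* In characteristic 2, [h(a) = 0] and [b^2 = f(a)]; as [q^n] is even,
     [b = b^(q^n) = f(a)^(q^n / 2)]. *)
  exists (f ^+ (#|F| ^ n)./2).
  by rewrite rmorphXn horner_exp -eb -exprM mul2n even_halfK.
exists (- (2%:R)^-1 *: h); rewrite linearZ /= hornerZ.
have K2 : 2%:R != 0 :> K by rewrite -(rmorph_nat iota) fmorph_eq0.
apply: (mulfI K2); rewrite mulrA rmorphN fmorphV rmorph_nat mulrN mulfV // mulN1r.
by move/eqP: ram; rewrite addr_eq0 => /eqP ->.
Qed.

End AlgebraicElement.

(** * Curves [Y^2 + h(X) Y = f(X)] and their derivations *)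

Section Evaluation.
Variables (A B : comNzRingType) (s : {rmorphism A -> B}).

Definition evp (x : B) (p : {poly A}) : B := (map_poly s p).[x].
(** The outer indeterminate receives [x] and the inner one [y], as in [chart_fun] and [chart_val],
    which are therefore convertible to instances of [ev2]. *)
Definition ev2 (x y : B) (n : {poly {poly A}}) : B :=
  (map_poly (map_poly s) n).[x%:P].[y].

Section At.
Variable x : B.

Lemma evp_is_additive : zmod_morphism (evp x).
Proof. by move=> p q; rewrite /evp rmorphB hornerD hornerN. Qed.
Lemma evp_is_monoid : monoid_morphism (evp x).
Proof. by split=> [|p q]; rewrite /evp ?rmorph1 ?hornerC // rmorphM hornerM. Qed.
HB.instance Definition _ :=
  GRing.isZmodMorphism.Build {poly A} B (evp x) evp_is_additive.
HB.instance Definition _ :=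
  GRing.isMonoidMorphism.Build {poly A} B (evp x) evp_is_monoid.

Lemma evpC c : evp x c%:P = s c.
Proof. by rewrite /evp map_polyC hornerC. Qed.
Lemma evpX : evp x 'X = x.
Proof. by rewrite /evp map_polyX hornerX. Qed.
Lemma evpZ c p : evp x (c *: p) = s c * evp x p.
Proof. by rewrite -mul_polyC rmorphM /= evpC. Qed.
Lemma evp0 : evp x 0 = 0. Proof. exact: rmorph0. Qed.
Lemma evp1 : evp x 1 = 1. Proof. exact: rmorph1. Qed.
Lemma evpN p : evp x (- p) = - evp x p. Proof. exact: rmorphN. Qed.
Lemma evpD p q : evp x (p + q) = evp x p + evp x q. Proof. exact: rmorphD. Qed.
Lemma evpM p q : evp x (p * q) = evp x p * evp x q. Proof. exact: rmorphM. Qed.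
Lemma evpXn p n : evp x (p ^+ n) = evp x p ^+ n. Proof. exact: rmorphXn. Qed.
Lemma evp_nat n : evp x n%:R = n%:R. Proof. exact: rmorph_nat. Qed.
Definition evpE := (evp0, evp1, evpN, evpD, evpM, evpXn, evp_nat, evpC, evpX).

End At.

Section At2.
Variables x y : B.

Lemma ev2_is_additive : zmod_morphism (ev2 x y).
Proof. by move=> p q; rewrite /ev2 rmorphB !hornerE. Qed.
Lemma ev2_is_monoid : monoid_morphism (ev2 x y).
Proof. by split=> [|p q]; rewrite /ev2 ?rmorph1 ?hornerC // rmorphM !hornerM. Qed.
HB.instance Definition _ :=
  GRing.isZmodMorphism.Build {poly {poly A}} B (ev2 x y) ev2_is_additive.
HB.instance Definition _ :=
  GRing.isMonoidMorphism.Build {poly {poly A}} B (ev2 x y) ev2_is_monoid.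

Lemma ev2C c : ev2 x y c%:P = evp y c.
Proof. by rewrite /ev2 map_polyC hornerC. Qed.
Lemma ev2X : ev2 x y 'X = x.
Proof. by rewrite /ev2 map_polyX hornerX hornerC. Qed.
Lemma ev2P p : ev2 x y p^:P = evp x p.
Proof.
elim/poly_ind: p => [|p c IH]; first by rewrite !rmorph0.
by rewrite !rmorphD !rmorphM /= IH map_polyX ev2X evpX map_polyC /= ev2C !evpC.
Qed.

End At2.
End Evaluation.

(* [n = al + be y] modulo [y^2 + h y - f], hence at every point of the curve, *)
(* with coordinates in any ring.                                             *)
Lemma ev2_reduce (A : comNzRingType) (h f : {poly A}) (n : {poly {poly A}}) :
  exists al be : {poly A}, forall (B : comNzRingType) (s : {rmorphism A -> B}) x y,
    y ^+ 2 + evp s x h * y = evp s x f ->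
    ev2 s x y n = evp s x al + evp s x be * y.
Proof.
elim/poly_ind: n => [|n c [al [be IH]]].
  by exists 0, 0 => B s x y _; rewrite !rmorph0 mul0r addr0.
have [al' [be' IHc]] : exists al be : {poly A},
    forall (B : comNzRingType) (s : {rmorphism A -> B}) x y,
    y ^+ 2 + evp s x h * y = evp s x f ->
    evp s y c = evp s x al + evp s x be * y.
  elim/poly_ind: c => [|c k [al' [be' IHc]]].
    by exists 0, 0 => B s x y _; rewrite !rmorph0 mul0r addr0.
  (* Multiply [al' + be' y] by [y] and replace [y^2] by [f - h y]. *)
  exists (be' * f + k%:P), (al' - be' * h) => B s x y e.
  rewrite !(rmorphD, rmorphB, rmorphM) /= !evpC evpX (IHc _ _ _ _ e) -e; ring.
exists (al * 'X + al'), (be * 'X + be') => B s x y e.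
rewrite !(rmorphD, rmorphM) /= ev2C ev2X !evpX (IHc _ _ _ _ e) (IH _ _ _ _ e).
ring.
Qed.

Definition derivation_over (F E : fieldType) (s : F -> E) (d : E -> E) : Prop :=
  [/\ forall c, d (s c) = 0,
      forall a b, d (a + b) = d a + d b &
      forall a b, d (a * b) = d a * b + a * d b].

Section DerivationTheory.
Variables (F E : fieldType) (s : {rmorphism F -> E}) (d : E -> E).
Hypothesis dP : derivation_over s d.

Lemma der0 : d 0 = 0.
Proof. by case: dP => d0 _ _; have := d0 0; rewrite rmorph0. Qed.

Lemma der1 : d 1 = 0.
Proof. by case: dP => d0 _ _; have := d0 1; rewrite rmorph1. Qed.

Lemma derD a b : d (a + b) = d a + d b. Proof. by case: dP. Qed.

Lemma derM a b : d (a * b) = d a * b + a * d b. Proof. by case: dP. Qed.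

Lemma derN a : d (- a) = - d a.
Proof. by apply/eqP; rewrite -addr_eq0 -derD addNr der0. Qed.

Lemma der_evp x p : d (evp s x p) = evp s x p^`() * d x.
Proof.
elim/poly_ind: p => [|p c IH]; first by rewrite deriv0 rmorph0 mul0r der0.
rewrite rmorphD rmorphM /= evpC evpX derivD derivC addr0 derivM derivX mulr1.
rewrite rmorphD rmorphM /= evpX derD derM IH; case: dP => -> _ _; ring.
Qed.

Lemma der_div n g : g != 0 -> d (n / g) = (d n - n / g * d g) / g.
Proof.
move=> g0; have /(congr1 d) := divfK g0 n; rewrite derM => <-.
by rewrite addrK mulfK.
Qed.

Lemma der_divE n g : g != 0 -> d (n / g) = (d n * g - n * d g) / g ^+ 2.
Proof. by move=> g0; rewrite der_div //; field. Qed.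

End DerivationTheory.

Section Chart.
Variables (F : fieldType) (E : fieldType) (cst : {rmorphism F -> E}).
Variables (h f : {poly F}) (X Y : E).
Local Notation "p ^X" := (evp cst X p) (at level 2, format "p ^X").

(* [E] is the function field of [Y^2 + h(X) Y = f(X)]. *)
Record chart_model : Prop := ChartModel {
  chart_eq : Y ^+ 2 + h^X * Y = f^X;
  chart_indep : forall al be, al^X + be^X * Y = 0 -> al = 0 /\ be = 0;
  chart_span : forall e, exists al be ga,
    ga != 0 /\ e = (al^X + be^X * Y) / ga^X }.

Hypothesis CM : chart_model.

Lemma evpX_neq0 p : p != 0 -> p^X != 0.
Proof.
move=> p0; apply: contra_neq p0 => e.
have [] // := chart_indep CM (al := p) (be := 0).
by rewrite e rmorph0 mul0r addr0.
Qed.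

(** For [G = Y^2 + h Y - f] these are [dG/dY] and [- dG/dX]: the derivation sending [X] and [Y] to
    them kills [G] without any division, and at a nonsingular point they do not both vanish. Below,
    [dn al be] is its value on [al + be Y]. *)
Let DX := 2%:R * Y + h^X.
Let DY := f^`()^X - h^`()^X * Y.

Let dn al be := (al^`()^X + be^`()^X * Y) * DX + be^X * DY.

Let dnM al be ga :
  dn (al * ga) (be * ga) = dn al be * ga^X + (al^X + be^X * Y) * (ga^`()^X * DX).
Proof. by rewrite /dn !derivM !(rmorphD, rmorphM) /=; ring. Qed.

Let dnD al be al' be' : dn (al + al') (be + be') = dn al be + dn al' be'.
Proof. by rewrite /dn !derivD !(rmorphD, rmorphM) /=; ring. Qed.

Let rep_ex e : exists r : {poly F} * {poly F} * {poly F},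
  (r.2 != 0) && (e == (r.1.1^X + r.1.2^X * Y) / r.2^X).
Proof.
have [al [be [ga [g0 ->]]]] := chart_span CM e.
by exists (al, be, ga); rewrite g0 eqxx.
Qed.

(** The quotient rule applied to a chosen fraction; [D_frac] shows that the choice does not
    matter. *)
Let D e := let r := xchoose (rep_ex e) in
  (dn r.1.1 r.1.2 * r.2^X - (r.1.1^X + r.1.2^X * Y) * (r.2^`()^X * DX)) / r.2^X ^+ 2.

Let D_frac al be ga : ga != 0 ->
  D ((al^X + be^X * Y) / ga^X) =
  (dn al be * ga^X - (al^X + be^X * Y) * (ga^`()^X * DX)) / ga^X ^+ 2.
Proof.
move=> g0; rewrite /D; set e := (al^X + be^X * Y) / ga^X.
case: (xchoose _) (xchooseP (rep_ex e)) => -[al1 be1] ga1 /= /andP[g10 /eqP].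
have gX0 := evpX_neq0 g0; have g1X0 := evpX_neq0 g10.
rewrite {}/e => /eqP; rewrite eqr_div // => /eqP e.
have [e1 e2] : al * ga1 = al1 * ga /\ be * ga1 = be1 * ga.
  have [] := chart_indep CM (al := al * ga1 - al1 * ga) (be := be * ga1 - be1 * ga).
    rewrite !(rmorphB, rmorphM) /=.
    have -> : forall a b c d : E, a - b + (c - d) * Y = (a + c * Y) - (b + d * Y).
      by move=> *; ring.
    by apply/eqP; rewrite subr_eq0; apply/eqP; move: e; rewrite !mulrDl => e;
      rewrite [_ * Y]mulrAC e; ring.
  by move=> /eqP; rewrite subr_eq0 => /eqP -> /eqP; rewrite subr_eq0 => /eqP ->.
have := congr2 dn e1 e2; rewrite !dnM => ed.
move: e ed; set N := _ + _ * Y; set N1 := al1^X + _ * Y.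
set g := ga^X; set g1 := ga1^X; set g' := ga^`()^X * DX; set g1' := ga1^`()^X * DX.
move: (dn al be) (dn al1 be1) => d d1 e ed.
apply/eqP; rewrite eqr_div ?expf_neq0 // -subr_eq0.
have -> : (d1 * g1 - N1 * g1') * g ^+ 2 - (d * g - N * g') * g1 ^+ 2 =
  g * g1 * ((d1 * g + N1 * g') - (d * g1 + N * g1'))
  + (g' * g1 + g * g1') * (N * g1 - N1 * g) by ring.
by rewrite ed e !subrr !mulr0 addr0.
Qed.

Lemma chart_derivation : exists d : E -> E,
  [/\ derivation_over cst d, d X = DX & d Y = DY].
Proof.
have X1 : (1 : {poly F})^X = 1 by rewrite rmorph1.
have X0 : (0 : {poly F})^X = 0 by rewrite rmorph0.
have o0 : (1 : {poly F}) != 0 by apply: oner_neq0.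
have d1 : (1 : {poly F})^`() = 0 by rewrite -polyC1 derivC.
exists D; split; first split.
- move=> c; rewrite (_ : cst c = (c%:P^X + 0^X * Y) / 1^X); last first.
    by rewrite X0 X1 evpC mul0r addr0 divr1.
  by rewrite D_frac // /dn d1 deriv0 derivC X0 !(mul0r, addr0, mulr0, subr0).
- move=> a b.
  have [al [be [ga [g0 ->]]]] := chart_span CM a.
  have [al1 [be1 [ga1 [g10 ->]]]] := chart_span CM b.
  have gX0 := evpX_neq0 g0; have g1X0 := evpX_neq0 g10.
  rewrite (_ : _ / _ + _ = ((al * ga1 + al1 * ga)^X + (be * ga1 + be1 * ga)^X * Y)
     / (ga * ga1)^X); last by rewrite !(rmorphD, rmorphM) /=; field; rewrite gX0 g1X0.
  rewrite !D_frac ?mulf_neq0 // dnD !dnM derivM !(rmorphD, rmorphM) /=.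
  by field; rewrite gX0 g1X0.
- move=> a b.
  have [al [be [ga [g0 ->]]]] := chart_span CM a.
  have [al1 [be1 [ga1 [g10 ->]]]] := chart_span CM b.
  have gX0 := evpX_neq0 g0; have g1X0 := evpX_neq0 g10.
  have eY := chart_eq CM.
  rewrite (_ : _ / _ * _ = ((al * al1 + be * be1 * f)^X
     + (al * be1 + al1 * be - be * be1 * h)^X * Y)
     / (ga * ga1)^X); last first.
    by rewrite !(rmorphD, rmorphB, rmorphM) /= -eY; field; rewrite gX0 g1X0.
  rewrite !D_frac ?mulf_neq0 // /dn !(derivM, derivD, derivN).
  rewrite !(rmorphD, rmorphN, rmorphM) /=.
  by rewrite /DX /DY -eY; field; rewrite gX0 g1X0.
- rewrite (_ : D X = D ((evp cst X 'X + 0^X * Y) / 1^X)); last first.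
    by rewrite X0 X1 evpX mul0r addr0 divr1.
  by rewrite D_frac // /dn derivX d1 deriv0 X1 X0 expr1n divr1
    !(mul0r, mulr0, mul1r, mulr1, addr0, add0r, subr0).
- rewrite (_ : D Y = D ((0^X + 1^X * Y) / 1^X)); last first.
    by rewrite X0 X1 mul1r add0r divr1.
  by rewrite D_frac // /dn d1 deriv0 X1 X0 expr1n divr1
    !(mul0r, mulr0, mul1r, mulr1, addr0, add0r, subr0).
Qed.

Lemma derivation_unique d1 d2 : derivation_over cst d1 -> derivation_over cst d2 ->
  d1 X = d2 X -> d1 Y = d2 Y -> d1 =1 d2.
Proof.
move=> P1 P2 eX eY e; have [al [be [ga [g0 ->]]]] := chart_span CM e.
have gX0 := evpX_neq0 g0.
rewrite (der_divE P1) // (der_divE P2) // (derD P1) (derD P2) (derM P1) (derM P2).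
by rewrite !(der_evp P1) !(der_evp P2) eX eY.
Qed.

(** Applying [d1] to the curve equation gives [DX * d1 Y = DY * d1 X], so both sides agree on [X]
    and [Y], and these determine a derivation. *)
Lemma derivation_proportional d1 d2 : derivation_over cst d1 -> derivation_over cst d2 ->
  d2 X = DX -> d2 Y = DY -> DX != 0 -> forall e, d1 e = d1 X / DX * d2 e.
Proof.
move=> P1 P2 eX eY nz.
apply: derivation_unique => //.
- split.
  + by move=> c; case: P2 => -> _ _; rewrite mulr0.
  + by move=> a b; rewrite (derD P2) mulrDr.
  + by move=> a b; rewrite (derM P2); ring.
- by rewrite eX divfK.
have /(congr1 d1) := chart_eq CM.
rewrite (derD P1) expr2 !(derM P1) !(der_evp P1) => e.
rewrite eY; apply: (mulIf nz); rewrite mulrAC divfK // /DY /DX.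
have -> : d1 X * (f^`()^X - h^`()^X * Y) = f^`()^X * d1 X - h^`()^X * d1 X * Y by ring.
rewrite -e; ring.
Qed.

End Chart.

(** * Local theory at a point of a chart *)

(** The localization at the kernel of [v] of the image of [u], together with its residue map. It is
    well defined once [v] kills the kernel of [u]. *)
Definition frac_place (R : Type) (E K : fieldType) (u : R -> E) (v : R -> K)
    (phi : E) (w : K) : Prop :=
  exists n d, [/\ v d != 0, phi = u n / u d & w = v n / v d].

Section FractionPlace.
Variables (R : comNzRingType) (E K : fieldType).
Variables (u : {rmorphism R -> E}) (v : {rmorphism R -> K}).

Hypothesis uv : forall n, u n = 0 -> v n = 0.

Lemma frac_placeP : place (frac_place u v).
Proof.
have uv0 n : v n != 0 -> u n != 0 by exact/contra_neq/uv.
split.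
- move=> x y w [n [d [d0 -> ->]]] [n1 [d1 [d10 /eqP e ->]]].
  apply/eqP; move: e; rewrite !eqr_div ?uv0 // -!rmorphM => /eqP e.
  rewrite -subr_eq0 -rmorphB; apply/eqP/uv.
  by rewrite rmorphB e subrr.
- by exists 1, 1; rewrite !rmorph1 !divr1 oner_eq0.
- move=> x y w w' [n [d [d0 -> ->]]] [n1 [d1 [d10 -> ->]]].
  have e0 := uv0 _ d0; have e10 := uv0 _ d10.
  exists (n * d1 - n1 * d), (d * d1); rewrite !(rmorphM, rmorphB) /= mulf_neq0 //.
  by split=> //; field; rewrite ?d0 ?d10 ?e0 ?e10.
- move=> x y w w' [n [d [d0 -> ->]]] [n1 [d1 [d10 -> ->]]].
  exists (n * n1), (d * d1); rewrite !rmorphM /= mulf_neq0 //.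
  by split=> //; rewrite invfM mulrACA.
- move=> x w [n [d [d0 -> ->]]]; rewrite mulf_eq0 negb_or => /andP[n0 _].
  by exists d, n; rewrite !invf_div.
Qed.

Lemma frac_place_mem n : frac_place u v (u n) (v n).
Proof. by exists n, 1; rewrite !rmorph1 !divr1 oner_eq0. Qed.

End FractionPlace.

Section ChartPlace.
Variables (F K : fieldType) (iota : {rmorphism F -> K}).
Variables (E : fieldType) (cst : {rmorphism F -> E}).
Variables (h f : {poly F}) (X Y : E).
Hypothesis CM : chart_model cst h f X Y.
Local Notation "p ^X" := (evp cst X p) (at level 2, format "p ^X").

Variables a b : K.
Local Notation "p ^a" := (evp iota a p) (at level 2, format "p ^a").

Definition chart_place : E -> K -> Prop := frac_place (ev2 cst X Y) (ev2 iota a b).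

Hypothesis on_ab : b ^+ 2 + h^a * b = f^a.

Lemma ev2_vanish n : ev2 cst X Y n = 0 -> ev2 iota a b n = 0.
Proof.
have [al [be red]] := ev2_reduce h f n.
rewrite (red _ _ _ _ (chart_eq CM)) (red _ _ _ _ on_ab).
by case/(chart_indep CM) => -> ->; rewrite !evp0 mul0r addr0.
Qed.

Lemma ev2_neq0 n : ev2 iota a b n != 0 -> ev2 cst X Y n != 0.
Proof. exact/contra_neq/ev2_vanish. Qed.

Lemma chart_placeP : place chart_place.
Proof. exact/frac_placeP/ev2_vanish. Qed.
Local Notation PO := chart_placeP.
Local Notation O := chart_place.

Lemma chart_place_ev2 n : O (ev2 cst X Y n) (ev2 iota a b n).
Proof. exact: frac_place_mem. Qed.

Lemma chart_place_evp p : O p^X p^a.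
Proof. by have := chart_place_ev2 (map_poly polyC p); rewrite !ev2P. Qed.

Lemma chart_placeY : O Y b.
Proof. by have := chart_place_ev2 'X%:P; rewrite !ev2C !evpX. Qed.

Lemma chart_place_red al be : O (al^X + be^X * Y) (al^a + be^a * b).
Proof.
exact: (placeD PO (chart_place_evp al)
  (placeM PO (chart_place_evp be) chart_placeY)).
Qed.

Lemma chart_place_frac phi w : O phi w -> exists al be d,
  [/\ punit O d, phi = (al^X + be^X * Y) / d &
      w = 0 -> al^a + be^a * b = 0].
Proof.
move=> [n [d [d0 -> ->]]]; have [al [be red]] := ev2_reduce h f n.
exists al, be, (ev2 cst X Y d); split.
- by exists (ev2 iota a b d) => //; apply: chart_place_ev2.
- by rewrite (red _ _ _ _ (chart_eq CM)).
move/eqP; rewrite mulf_eq0 invr_eq0 (negPf d0) orbF => /eqP.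
by rewrite (red _ _ _ _ on_ab).
Qed.

(* The second factor is the conjugate [al + be (- h - Y)] of the first. *)
Lemma norm_eq al be : (al^X + be^X * Y) * (al^X - be^X * (h^X + Y)) =
  (al ^+ 2 - al * be * h - be ^+ 2 * f)^X.
Proof. by rewrite !evpE -(chart_eq CM); ring. Qed.

Lemma evp_integral p : integral O p^X.
Proof. by eexists; apply: chart_place_evp. Qed.

Lemma chartY_integral : integral O Y.
Proof. by eexists; apply: chart_placeY. Qed.

(** [d X] and [d Y] are polynomials in [X] and [Y], and the denominator in the quotient rule is a
    unit at the point. *)
Lemma chart_der_integral d phi : derivation_over cst d ->
  d X = 2%:R * Y + h^X -> d Y = f^`()^X - h^`()^X * Y ->
  integral O phi -> integral O (d phi).
Proof.
move=> dP dX dY [w [n [g [g0 -> _]]]].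
have iX := evp_integral; have iY := chartY_integral.
have i2 : integral O 2%:R by have := iX 2%:R; rewrite evp_nat.
have idX : integral O (d X).
  by rewrite dX; apply: (integralD PO) => //; apply: (integralM PO).
have idY : integral O (d Y).
  by rewrite dY; apply: (integralB PO) => //; apply: (integralM PO).
have gX0 := ev2_neq0 g0.
have uV : punit O (ev2 cst X Y g)^-1.
  by apply: (punitV PO); exists (ev2 iota a b g) => //; apply: chart_place_ev2.
have dev k : integral O (d (ev2 cst X Y k)).
  have [al [be red]] := ev2_reduce h f k.
  rewrite (red _ _ _ _ (chart_eq CM)) (derD dP) (derM dP) !(der_evp dP).
  by do ![apply: (integralD PO) => // | apply: (integralM PO) => //].
rewrite (der_div dP) //; apply: (integralM PO) (punit_integral uV).
apply: (integralB PO) => //; apply: (integralM PO) => //.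
apply: (integralM PO) (punit_integral uV).
by eexists; apply: chart_place_ev2.
Qed.

End ChartPlace.

Arguments chart_place_evp {F K iota E cst X Y a b} p.
Arguments chart_place_ev2 {F K iota E cst X Y a b} n.
Arguments chart_placeY {F K iota E cst X Y a b}.
Arguments evp_integral {F K iota E cst X Y a b} p.
Arguments chartY_integral {F K iota E cst X Y a b}.

(** * Uniformizers and orders at a nonsingular point of a chart *)

Section PointOnChart.
Variables (F : finFieldType) (K : closedFieldType) (iota : {rmorphism F -> K}).
Variables (E : fieldType) (cst : {rmorphism F -> E}).
Variables (h f : {poly F}) (X Y : E).
Hypothesis CM : chart_model cst h f X Y.
Hypothesis K_algebraic : integralRange iota.
Local Notation "p ^X" := (evp cst X p) (at level 2, format "p ^X").

Section AtPoint.
Variables a b : K.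
Local Notation "p ^a" := (evp iota a p) (at level 2, format "p ^a").
Hypothesis on_ab : b ^+ 2 + h^a * b = f^a.
Let PO := chart_placeP CM on_ab.
Local Notation O := (chart_place iota cst X Y a b).

(** The ramification index over the [X]-line: it is 2 exactly at the fixed points of the involution
    [(X, Y) -> (X, - h - Y)]. *)
Definition ram_index : nat := if 2%:R * b + h^a == 0 then 2%N else 1%N.

Hypothesis nonsing : ~ (2%:R * b + h^a = 0 /\ h^`()^a * b - f^`()^a = 0).

Variable m : {poly F}.
Hypothesis ma : m^a = 0.
Hypothesis mdvd : forall p, p^a = 0 -> m %| p.
Hypothesis m'a : m^`()^a != 0.

Lemma minpoly_factor p : p^a = 0 -> exists2 q, p = q * m & p^X = q^X * m^X.
Proof. by move/mdvd/dvdpP => [q ->]; exists q; rewrite ?evpM. Qed.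

Lemma minpoly_neq0 : m != 0.
Proof. by apply: contra_neq m'a => ->; rewrite deriv0 evp0. Qed.

(* If the conjugate of a function vanishing at [(a, b)] does not vanish there, *)
(* divide [m], which divides the norm, by it; otherwise [m] divides both [al]  *)
(* and [be].                                                                   *)
Lemma unramified_uniformizer : 2%:R * b + h^a != 0 -> punif O m^X.
Proof.
move=> unr; split; first exact: evpX_neq0 CM _ minpoly_neq0.
  by rewrite -ma; apply: chart_place_evp.
move=> s /(chart_place_frac CM on_ab) [al [be [d [ud -> /(_ erefl) nP]]]].
have mX0 := evpX_neq0 CM minpoly_neq0; have d0 := punit_neq0 PO ud.
rewrite mulrAC; apply: (integralM PO) (punit_integral (punitV PO ud)).
have Oc : O (al^X - be^X * (h^X + Y)) (al^a - be^a * (h^a + b)).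
  apply: (placeB PO (chart_place_evp _)) (placeM PO (chart_place_evp _) _).
  exact: (placeD PO (chart_place_evp _) chart_placeY).
have [c0|c0] := eqVneq (al^a - be^a * (h^a + b)) 0.
  have be0 : be^a = 0.
    apply: (mulIf unr); rewrite mul0r -[RHS](subrr 0) -{1}nP -c0; ring.
  have al0 : al^a = 0 by move: nP; rewrite be0 mul0r addr0.
  have [q1 _ ->] := minpoly_factor al0; have [q2 _ ->] := minpoly_factor be0.
  have -> : (q1^X * m^X + q2^X * m^X * Y) / m^X = q1^X + q2^X * Y by field.
  by exists (q1^a + q2^a * b); apply: (chart_place_red CM on_ab).
have uc : punit O (al^X - be^X * (h^X + Y)) by eexists; eauto.
have /minpoly_factor [q _ eq] : (al ^+ 2 - al * be * h - be ^+ 2 * f)^a = 0.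
  rewrite !evpE -on_ab.
  rewrite -[RHS](mul0r (al^a - be^a * (h^a + b))) -nP; ring.
have e : (al^X + be^X * Y) / m^X = q^X / (al^X - be^X * (h^X + Y)).
  by apply/eqP; rewrite eqr_div ?(punit_neq0 PO uc) // (norm_eq CM) eq.
rewrite e; apply: (integralM PO) (punit_integral (punitV PO uc)).
by eexists; apply: chart_place_evp.
Qed.

Section Ramified.
Hypothesis ram : 2%:R * b + h^a = 0.
Variable v : {poly F}.
Hypothesis va : v^a = b.

(** The product is the norm [v^2 + h v - f] of [Y - v]. It vanishes at [a], and its derivative there
    is [h'(a) b - f'(a)] because [2 b + h(a) = 0]; nonsingularity makes this nonzero, so the
    cofactor of [m] does not vanish. *)
Lemma ramified_norm : exists2 w, w^a != 0 &
  (Y - v^X) * (- v^X - (h^X + Y)) = w^X * m^X.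
Proof.
have e0 : (v ^+ 2 + v * h - f)^a = 0.
  by rewrite !evpE va -on_ab; ring.
have [w ew eX] := minpoly_factor e0; exists w; last first.
  rewrite -eX !evpE -(chart_eq CM); ring.
apply/eqP => w0; have /(congr1 (evp iota a)) := congr1 (@deriv _) ew.
rewrite [in RHS]derivM [in RHS]evpD ![in RHS]evpM w0 ma mulr0 mul0r addr0.
rewrite expr2 !(derivD, derivN, derivM) !evpE va => e.
apply: nonsing; split=> //; rewrite -e -[LHS]addr0 -(mulr0 v^`()^a) -ram; ring.
Qed.

Lemma Y_sub_neq0 : Y - v^X != 0.
Proof.
apply/eqP => e.
have [|_ /eqP] := chart_indep CM (al := - v) (be := 1).
  by rewrite evpN evp1 mul1r addrC.
by rewrite oner_eq0.
Qed.

Lemma Y_sub_place : O (Y - v^X) 0.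
Proof.
by have := placeB PO chart_placeY (chart_place_evp v); rewrite va subrr.
Qed.

Lemma conj_place : O (- v^X - (h^X + Y)) 0.
Proof.
have := placeB PO (placeN PO (chart_place_evp v))
  (placeD PO (chart_place_evp h) chart_placeY).
have -> : - evp iota a v - (h^a + b) = - (2%:R * b + h^a) by rewrite va; ring.
by rewrite ram oppr0.
Qed.

(** Split [al + be Y] as [be (Y - v) + (al + be v)]. The second term is a polynomial in [X]
    vanishing at [a], hence a multiple of [m], and [m] is a multiple of [Y - v] by
    [ramified_norm]. *)
Lemma ramified_uniformizer : punif O (Y - v^X).
Proof.
split; [exact: Y_sub_neq0 | exact: Y_sub_place |].
move=> s /(chart_place_frac CM on_ab) [al [be [d [ud -> /(_ erefl) nP]]]].
have t0 := Y_sub_neq0; have d0 := punit_neq0 PO ud.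
rewrite mulrAC; apply: (integralM PO) (punit_integral (punitV PO ud)).
have /minpoly_factor [s1 _ es] : (al + be * v)^a = 0.
  by rewrite !evpE va.
have [w wa ew] := ramified_norm.
have uw : punit O w^X by exists w^a => //; apply: chart_place_evp.
have w0 := punit_neq0 PO uw.
have em : m^X = (Y - v^X) * (- v^X - (h^X + Y)) / w^X.
  by rewrite ew mulrAC mulfV // mul1r.
have -> : (al^X + be^X * Y) / (Y - v^X) = be^X + s1^X * (- v^X - (h^X + Y)) / w^X.
  apply: (mulIf t0); rewrite divfK // mulrDl.
  have -> : al^X + be^X * Y = be^X * (Y - v^X) + (al + be * v)^X.
    by rewrite !evpE; ring.
  by rewrite es em; congr (_ + _); field.
apply: (integralD PO); first exact: evp_integral.
apply: (integralM PO) (punit_integral (punitV PO uw)).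
by apply: (integralM PO); [apply: evp_integral | eexists; apply: conj_place].
Qed.

(* At a ramified point [2 Y + h] vanishes, so the conjugate of the uniformizer *)
(* [t = Y - v] is [- t] up to a multiple of [m].                               *)
Lemma ramified_ord : pord O m^X 2.
Proof.
have t0 := Y_sub_neq0; exists (Y - v^X); first exact: ramified_uniformizer.
have [w wa ew] := ramified_norm.
have /minpoly_factor [s _ es] : (2%:R * v + h)^a = 0.
  by rewrite !evpE va.
have uw : punit O (w^X + (Y - v^X) * s^X).
  apply: (punitD PO); first by exists w^a => //; apply: chart_place_evp.
  by apply: (place_maxM PO) (evp_integral _); apply: Y_sub_place.
have u0 := punit_neq0 PO uw.
have -> : m^X = - ((Y - v^X) ^ 2 / (w^X + (Y - v^X) * s^X)).
  apply: (mulIf u0); rewrite mulNr divfK // mulrDr [m^X * w^X]mulrC -ew.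
  rewrite mulrCA [m^X * _]mulrC -es !evpE.
  by rewrite -exprnP; ring.
rewrite mulNr mulrAC mulfV ?expfz_neq0 // mul1r.
exact/(punitN PO)/(punitV PO).
Qed.

Lemma ramified_der (d : E -> E) : derivation_over cst d ->
  d X = 2%:R * Y + h^X -> d Y = f^`()^X - h^`()^X * Y -> punit O (d (Y - v^X)).
Proof.
move=> dP dX dY; rewrite (derD dP) (derN dP) (der_evp dP) dX dY.
have := placeB PO (placeB PO (chart_place_evp f^`())
  (placeM PO (chart_place_evp h^`()) chart_placeY))
  (placeM PO (chart_place_evp v^`())
    (placeD PO (placeM PO (chart_place_evp 2%:R) chart_placeY) (chart_place_evp h))).
rewrite !evp_nat ram mulr0 subr0 => Od; eexists; last exact: Od.
by apply/eqP => e; apply: nonsing; split=> //; rewrite -opprB e oppr0.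
Qed.

(** Dividing [be (Y - v) = psi ga - (al + be v)] by [Y - v] presents [be] as an integral multiple of
    [m / (Y - v)], which has order [2 - 1 > 0]. *)
Lemma ramified_numerator al be ga psi : integral O psi -> ga^a = 0 ->
  al^X + be^X * Y = psi * ga^X -> al^a + be^a * b = 0 -> be^a = 0.
Proof.
move=> ipsi /minpoly_factor [q _ ->] en nP; have t0 := Y_sub_neq0.
have /minpoly_factor [s _ es] : (al + be * v)^a = 0.
  by rewrite !evpE va.
have e : be^X = m^X / (Y - v^X) * (psi * q^X - s^X).
  apply: (mulIf t0).
  have -> : m^X / (Y - v^X) * (psi * q^X - s^X) * (Y - v^X) =
    psi * (q^X * m^X) - s^X * m^X by field.
  by rewrite -es -en !evpE; ring.
apply: (place_fun PO (chart_place_evp be)); rewrite e.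
apply: (place_maxM PO).
  by apply: (pord_gt0 PO (pord_div PO ramified_ord (punif_ord PO ramified_uniformizer))).
by apply: (integralB PO) (evp_integral _); apply: (integralM PO) ipsi (evp_integral _).
Qed.

End Ramified.

(** The uniformizer is [m] at an unramified point and [Y - v] at a ramified one. The value of its
    derivative is [m'(a) (2 b + h(a))] in the first case and [f'(a) - h'(a) b] in the second. *)
Lemma minpoly_ord : exists t, [/\ punif O t, pord O m^X ram_index &
  forall d, derivation_over cst d -> d X = 2%:R * Y + h^X ->
    d Y = f^`()^X - h^`()^X * Y -> punit O (d t)].
Proof.
rewrite /ram_index; case: eqVneq => [ram|unr].
  have [v va] := ramified_lift K_algebraic on_ab ram.
  exists (Y - v^X); split; first exact: ramified_uniformizer.
    exact: ramified_ord va.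
  by move=> d; apply: ramified_der.
have um := unramified_uniformizer unr.
exists m^X; split=> //; first exact: punif_ord.
move=> d dP dX dY; rewrite (der_evp dP) dX.
apply: (punitM PO); first by eexists; [exact: m'a | apply: chart_place_evp].
eexists; first exact: unr.
have := placeD PO (placeM PO (chart_place_evp 2%:R) chart_placeY) (chart_place_evp h).
by rewrite !evp_nat.
Qed.

Lemma minpoly_mup : mup a (map_poly iota m) = 1%N.
Proof.
have m0 : map_poly iota m != 0 by rewrite map_poly_eq0 minpoly_neq0.
apply/eqP; rewrite eqn_leq mup_leq // -XsubC_dvd // dvdp_XsubCl rootE.
apply/andP; split; last exact/eqP.
apply/negP => /dvdpP [q eq]; move/eqP: m'a; apply.
rewrite /evp -deriv_map eq expr2 !derivM.
by rewrite !(hornerD, hornerM, hornerN, hornerX, hornerC) subrr; ring.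
Qed.

Lemma evp_ord p : p != 0 -> pord O p^X (ram_index * mup a (map_poly iota p))%N.
Proof.
have [t [ut om _]] := minpoly_ord.
have [k] := ubnP (size p); elim: k p => // k IH p; rewrite ltnS => sp p0.
have [pa|pa] := eqVneq (p^a) 0; last first.
  rewrite mupNroot // muln0; apply: (punit_ord ut); exists p^a => //.
  exact: chart_place_evp.
have [q eq eX] := minpoly_factor pa; have m0 := minpoly_neq0.
have q0 : q != 0 by apply: contra_neq p0; rewrite eq => ->; rewrite mul0r.
have sm : (1 < size m)%N.
  by rewrite -(size_map_poly iota) (root_size_gt1 _ (introT rootP ma)) // map_poly_eq0.
rewrite eX eq [map_poly _ _]rmorphM /= mupM ?map_poly_eq0 // minpoly_mup.
rewrite mulnDr muln1 PoszD.
apply: (pordM PO) => //; apply: IH => //.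
move: sp sm; rewrite eq size_mul //; move: (size q) (size m); lia.
Qed.

End AtPoint.

Section AtPoint.
Variables a b : K.
Local Notation "p ^a" := (evp iota a p) (at level 2, format "p ^a").
Local Notation O := (chart_place iota cst X Y a b).
Hypothesis on_ab : b ^+ 2 + h^a * b = f^a.
Hypothesis nonsing : ~ (2%:R * b + h^a = 0 /\ h^`()^a * b - f^`()^a = 0).
Let PO := chart_placeP CM on_ab.

Lemma chart_unif_ord : exists t, [/\ punif O t,
  forall p, p != 0 -> pord O p^X (ram_index a b * mup a (map_poly iota p))%N &
  forall d, derivation_over cst d -> d X = 2%:R * Y + h^X ->
    d Y = f^`()^X - h^`()^X * Y -> punit O (d t)].
Proof.
have [m [ma mdvd m'a]] := separable_minpoly K_algebraic a.
have [t [ut _ Dt]] := minpoly_ord on_ab nonsing ma mdvd m'a.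
by exists t; split=> // p p0; apply: (evp_ord on_ab nonsing ma mdvd m'a).
Qed.

Lemma chart_ord_evp p : p != 0 ->
  pord O p^X (ram_index a b * mup a (map_poly iota p))%N.
Proof. by have [t [_ + _]] := chart_unif_ord; apply. Qed.

(** The norm of the numerator is a nonzero polynomial in [X], whose order is known, and the
    numerator is an integral factor of it, so [pord_factor] applies. *)
Lemma chart_ord_ex e : e != 0 -> exists k, pord O e k.
Proof.
have [t [ut op _]] := chart_unif_ord.
have [al [be [ga [g0 ->]]]] := chart_span CM e.
rewrite mulf_eq0 negb_or => /andP[n0 _].
have c0 : al^X - be^X * (h^X + Y) != 0.
  apply: contra_neq n0 => c0.
  have [|e1 e2] := chart_indep CM (al := al - be * h) (be := - be).
    by rewrite !evpE -c0; ring.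
  move/eqP: e2; rewrite oppr_eq0 => /eqP b0; move: e1; rewrite b0 mul0r subr0 => ->.
  by rewrite evp0 mul0r addr0.
have iY : integral O Y by eexists; apply: chart_placeY.
have iX p : integral O p^X by apply: evp_integral.
have N0 : al ^+ 2 - al * be * h - be ^+ 2 * f != 0.
  apply: contra_neq (mulf_neq0 n0 c0) => e0.
  by rewrite (norm_eq CM al be) e0 evp0.
have := op _ N0; rewrite -(norm_eq CM al be) => oN.
have [||l ol] := pord_factor PO ut _ _ oN.
- by apply: (integralD PO) => //; apply: (integralM PO).
- by apply: (integralB PO) => //; apply: (integralM PO) => //; apply: (integralD PO).
by exists (l - (ram_index a b * mup a (map_poly iota ga))%N%:Z);
  apply: (pord_div PO) => //; apply: op.
Qed.

(** With [t = u t1], where [u] is a unit and [t1] the uniformizer already treated,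
    [d t = u d t1 + t1 d u], and [d u] is integral. *)
Lemma chart_der_unit d t : derivation_over cst d -> d X = 2%:R * Y + h^X ->
  d Y = f^`()^X - h^`()^X * Y -> punif O t -> punit O (d t).
Proof.
move=> dP dX dY ut; have [t1 [ut1 _ /(_ d dP dX dY) ud]] := chart_unif_ord.
have [t10 Ot1 _] := ut1.
have uq := punif_div PO ut ut1.
rewrite -[t](divfK t10) (derM dP) addrC; apply: (punitD PO).
  exact: (punitM PO).
rewrite mulrC; apply: (place_maxM PO Ot1).
exact: (chart_der_integral CM on_ab dP dX dY (punit_integral uq)).
Qed.

Lemma regular_value al be ga psi : integral O psi -> ga^a = 0 ->
  al^X + be^X * Y = psi * ga^X -> al^a + be^a * b = 0.
Proof.
move=> ipsi ga0 en; apply: (place_fun PO (chart_place_red CM on_ab al be)).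
rewrite en mulrC; apply: (place_maxM PO) ipsi.
by rewrite -ga0; apply: chart_place_evp.
Qed.

End AtPoint.

(** The numerator vanishes at both points above [a]; subtracting the two equations gives
    [be(a) (2 b + h(a)) = 0]. When the two points coincide, [ramified_numerator] replaces this
    argument. *)
Lemma regular_numerator a b al be ga psi (b' := - evp iota a h - b) :
  b ^+ 2 + evp iota a h * b = evp iota a f ->
  ~ (2%:R * b + evp iota a h = 0 /\ evp iota a h^`() * b - evp iota a f^`() = 0) ->
  integral (chart_place iota cst X Y a b) psi ->
  integral (chart_place iota cst X Y a b') psi ->
  evp iota a ga = 0 -> al^X + be^X * Y = psi * ga^X ->
  evp iota a al = 0 /\ evp iota a be = 0.
Proof.
move=> on ns i1 i2 ga0 en.
have on' : b' ^+ 2 + evp iota a h * b' = evp iota a f by rewrite -on /b'; ring.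
have e1 := regular_value on i1 ga0 en; have e2 := regular_value on' i2 ga0 en.
suff be0 : evp iota a be = 0 by split=> //; move: e1; rewrite be0 mul0r addr0.
have [ram|unr] := eqVneq (2%:R * b + evp iota a h) 0.
  have [m [ma mdvd m'a]] := separable_minpoly K_algebraic a.
  have [v va] := ramified_lift K_algebraic on ram.
  exact: (ramified_numerator on ns ma mdvd ram va i1 ga0 en e1).
apply: (mulIf unr); rewrite mul0r -[RHS](subrr 0) -{1}e1 -e2 /b'; ring.
Qed.

Hypothesis nonsing : forall a b, b ^+ 2 + evp iota a h * b = evp iota a f ->
  ~ (2%:R * b + evp iota a h = 0 /\ evp iota a h^`() * b - evp iota a f^`() = 0).

(** The coordinate ring of a smooth affine curve is the ring of its everywhere regular functions. As
    long as the denominator has a root [a], the minimal polynomial of [a] cancels from [al], [be]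
    and [ga]. *)
Lemma regular_everywhere psi :
  (forall a b, b ^+ 2 + evp iota a h * b = evp iota a f ->
    integral (chart_place iota cst X Y a b) psi) ->
  exists al be, psi = al^X + be^X * Y.
Proof.
move=> reg; have [al [be [ga [g0 e]]]] := chart_span CM psi.
have gX0 := evpX_neq0 CM g0.
have {e} : al^X + be^X * Y = psi * ga^X by rewrite e divfK.
have [k] := ubnP (size ga); elim: k al be ga {gX0} g0 => // k IH al be ga g0 sk en.
have [sg|sg] := ltnP 1 (size ga); last first.
  have /size1_polyC ec := sg; move: g0 en; rewrite ec polyC_eq0; set c := ga`_0.
  move=> c0 en; exists (c^-1 *: al), (c^-1 *: be); rewrite !evpZ -mulrA -mulrDr en evpC.
  by rewrite fmorphV mulrC mulfK // fmorph_eq0.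
have [a /rootP ga0] : exists a, root (map_poly iota ga) a.
  by apply/closed_rootP; rewrite size_map_poly gtn_eqF.
have [b on] : exists b, b ^+ 2 + evp iota a h * b = evp iota a f.
  have [b] := @solve_monicpoly K 2
    (fun i => if i == 0%N then evp iota a f else - evp iota a h) isT.
  rewrite big_ord_recl big_ord1 /= expr0 expr1 mulr1 => e; exists b; rewrite e; ring.
have on' : (- evp iota a h - b) ^+ 2 + evp iota a h * (- evp iota a h - b) = evp iota a f.
  by rewrite -on; ring.
have [al0 be0] := regular_numerator on (nonsing on) (reg _ _ on) (reg _ _ on') ga0 en.
have [m [ma mdvd m'a]] := separable_minpoly K_algebraic a.
have m0 := minpoly_neq0 m'a.
have sm : (1 < size m)%N.
  by rewrite -(size_map_poly iota) (root_size_gt1 _ (introT rootP ma)) // map_poly_eq0.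
have [q1 _ e1] := minpoly_factor mdvd al0; have [q2 _ e2] := minpoly_factor mdvd be0.
have [q3 e3' e3] := minpoly_factor mdvd ga0.
have q0 : q3 != 0 by apply: contra_neq g0; rewrite e3' => ->; rewrite mul0r.
apply: (IH q1 q2 q3) => //.
  move: sk sm; rewrite e3' size_mul //; move: (size q3) (size m); lia.
apply: (mulIf (evpX_neq0 CM m0)); rewrite -mulrA -e3 -en e1 e2; ring.
Qed.

End PointOnChart.

(** * The chart at infinity *)

Section Reversal.
Variable F : fieldType.
Implicit Type p : {poly F}.

(** For [p] of degree at most [n] this is [x^n p(1/x)]; a degree below [n] yields a zero at 0. *)
Definition revp n p : {poly F} := \poly_(j < n.+1) p`_(n - j).

Lemma coef_revp n p i : (revp n p)`_i = if (i < n.+1)%N then p`_(n - i) else 0.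
Proof. by rewrite coef_poly. Qed.

Lemma evp_revp (E : fieldType) (s : {rmorphism F -> E}) (x : E) n p :
  x != 0 -> (size p <= n.+1)%N -> evp s x^-1 (revp n p) = evp s x p / x ^+ n.
Proof.
move=> x0 sp; rewrite /evp.
rewrite !(@horner_coef_wide _ n.+1) ?size_map_poly ?size_poly // mulr_suml.
rewrite (reindex_inj rev_ord_inj) /=; apply: eq_bigr => i _.
have le_in : (i <= n)%N by rewrite -ltnS.
rewrite !coef_map coef_revp subSS ltnS leq_subr subKn // -mulrA; congr (_ * _).
by rewrite -[in x ^+ n](subnK le_in) exprD exprVn invfM mulrCA mulfV ?mulr1 // expf_neq0.
Qed.

Lemma revp_eq0 n p : (size p <= n.+1)%N -> revp n p = 0 -> p = 0.
Proof.
move=> sp e; apply/polyP => i; rewrite coef0.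
have [le_in|lt_ni] := leqP i n; last by rewrite nth_default // (leq_trans sp).
have := congr1 (fun q : {poly F} => q`_(n - i)) e.
by rewrite coef_revp coef0 subKn // ltnS leq_subr.
Qed.

End Reversal.

Section ChartAtInfinity.
Variables (F : fieldType) (E : fieldType) (cst : {rmorphism F -> E}).
Variables (g : nat) (h f : {poly F}) (X Y : E).
Hypothesis CM : chart_model cst h f X Y.
Hypothesis size_h : (size h <= g.+1)%N.
Hypothesis size_f : size f = (2 * g).+2.

Lemma chart_X_neq0 : X != 0.
Proof. by have := evpX_neq0 CM (negbT (polyX_eq0 F)); rewrite evpX. Qed.

Local Notation Z := (X^-1).
Local Notation W := (Y / X ^+ g.+1).

Lemma infinity_chart : chart_model cst (revp g.+1 h) (revp (2 * g).+2 f) Z W.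
Proof.
have X0 := chart_X_neq0; have Xn n : X ^+ n != 0 by rewrite expf_neq0.
have Z0 : Z != 0 by rewrite invr_eq0.
have evZ (p : {poly F}) n : (size p <= n.+1)%N ->
    evp cst Z p = evp cst X (revp n p) * Z ^+ n.
  move=> sp; have := evp_revp cst Z0 sp; rewrite invrK => ->.
  by rewrite divfK // expf_neq0.
split.
- rewrite !evp_revp // ?size_f // -?(chart_eq CM); last by apply: leqW.
  have -> : (2 * g).+2 = (g.+1 + g.+1)%N by lia.
  by rewrite exprD; field.
- move=> al be; pose n := maxn (size al) (size be).
  have sa : (size al <= n.+1)%N by rewrite leqW // leq_maxl.
  have sb : (size be <= n.+1)%N by rewrite leqW // leq_maxr.
  rewrite (evZ _ _ sa) (evZ _ _ sb) => e.
  (* Multiplying the relation by [X^(n + g + 1)] clears all the denominators. *)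
  have [|ea eb] := chart_indep CM (al := revp n al * 'X ^+ g.+1) (be := revp n be).
    rewrite evpM evpXn evpX; apply: (mulIf (expf_neq0 n Z0)).
    apply: (mulIf (invr_neq0 (Xn g.+1))); rewrite !mul0r -[RHS]e; field.
    by rewrite ?X0 ?Xn.
  split; last exact: revp_eq0 eb.
  apply: (revp_eq0 sa); move/eqP: ea; rewrite mulf_eq0 => /orP[/eqP //|].
  by rewrite expf_eq0 polyX_eq0 andbF.
move=> e; have [al [be [ga [g0 ->]]]] := chart_span CM e.
pose n := maxn (size ga) (maxn (size al) (size be)).
have sc : (size ga <= n.+1)%N by rewrite leqW // leq_maxl.
have sa : (size al <= n.+1)%N by rewrite leqW // /n maxnCA leq_maxl.
have sb : (size be <= n.+1)%N by rewrite leqW // /n maxnA leq_maxr.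
have r0 : revp n ga != 0 by apply: contra_neq g0; apply: revp_eq0.
have gX := evpX_neq0 CM g0.
exists (revp n al * 'X ^+ g.+1), (revp n be), (revp n ga * 'X ^+ g.+1); split.
  by rewrite mulf_neq0 // expf_neq0 // polyX_eq0.
rewrite !evpM !evpXn evpX !evp_revp // exprVn.
move: (X ^+ n) (Xn n) (X ^+ g.+1) (Xn g.+1) => A A0 B B0.
by field; rewrite A0 B0 gX.
Qed.

End ChartAtInfinity.

(** * Divisibility over the base field and multiplicities of roots *)

Section Multiplicity.
Variables (F : fieldType) (K : closedFieldType) (iota : {rmorphism F -> K}).
Local Notation "p ^K" := (map_poly iota p) (at level 2, format "p ^K").

(** After division by the gcd, a root of what remains of [u] is not a root of what remains of [p],
    against the inequality of multiplicities there. *)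
Lemma dvdp_mup (u p : {poly F}) : u != 0 -> p != 0 ->
  (forall a, (mup a u^K <= mup a p^K)%N) -> u %| p.
Proof.
move=> u0 p0 le_up; set d := gcdp u p.
have eu : u %/ d * d = u by apply: divpK (dvdp_gcdl u p).
have ep : p %/ d * d = p by apply: divpK (dvdp_gcdr u p).
have d0 : d != 0 by rewrite gcdp_eq0 negb_and u0.
have u10 : u %/ d != 0 by apply: contra_neq u0 => e; rewrite -eu e mul0r.
have p10 : p %/ d != 0 by apply: contra_neq p0 => e; rewrite -ep e mul0r.
have cop : coprimep (u %/ d) (p %/ d) by apply: coprimep_div_gcd; rewrite u0.
have [s1|s1] := eqVneq (size (u %/ d)) 1%N.
  rewrite -eu; apply: dvdp_trans (dvdp_gcdr u p : d %| p).
  by have /size_poly1P [c c0 ->] := introT eqP s1; rewrite mul_polyC dvdpZl.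
have [a ra] : exists a, root (u %/ d)^K a.
  by apply/closed_rootP; rewrite size_map_poly.
have pa : ~~ root (p %/ d)^K a.
  move: cop; rewrite -(coprimep_map iota) => /coprimep_root /(_ ra).
  by rewrite rootE.
have := le_up a; rewrite -{1}eu -{1}ep [(_ * d)^K]rmorphM [(p %/ d * d)^K]rmorphM /=.
rewrite !mupM ?map_poly_eq0 // leq_add2r (mupNroot pa) leqNgt.
by rewrite -XsubC_dvd ?map_poly_eq0 // dvdp_XsubCl ra.
Qed.

(* A double root of [u] over a ramification point would be a singular point. *)
Lemma ramified_mup (h f u v : {poly F}) (a : K) : u != 0 ->
  u %| v ^+ 2 + h * v - f ->
  ~ (2%:R * evp iota a v + evp iota a h = 0 /\
     evp iota a h^`() * evp iota a v - evp iota a f^`() = 0) ->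
  2%:R * evp iota a v + evp iota a h = 0 -> (mup a u^K <= 1)%N.
Proof.
move=> u0 /dvdpP [q eq] ns ram; rewrite mup_leq ?map_poly_eq0 //.
apply/negP => /dvdpP [r er]; apply: ns; split=> //.
have e : (v ^+ 2 + h * v - f)^K = q^K * (r * ('X - a%:P) ^+ 2).
  by rewrite eq rmorphM /= er.
have /(congr1 (fun p => p.[a])) := congr1 (@deriv _) e.
rewrite deriv_map -[LHS]/(evp iota a _) expr2 !(derivD, derivN, derivM) !evpE.
rewrite !(hornerD, hornerM, hornerN, hornerX, hornerC) subrr => e1.
set L := (X in X = _) in e1.
have -> : evp iota a h^`() * evp iota a v - evp iota a f^`() =
  L - evp iota a v^`() * (2%:R * evp iota a v + evp iota a h) by rewrite /L; ring.
by rewrite ram e1; ring.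
Qed.

End Multiplicity.

(** * Orders at infinity and the regular differential *)

Section Hyperelliptic.
Variables (F : finFieldType) (K : closedFieldType) (iota : {rmorphism F -> K}).
Variables (E : fieldType) (cst : {rmorphism F -> E}).
Variables (g : nat) (h f : {poly F}) (X Y : E).
Hypothesis CM : chart_model cst h f X Y.
Hypothesis K_algebraic : integralRange iota.
Hypothesis size_h : (size h <= g.+1)%N.
Hypothesis size_f : size f = (2 * g).+2.
Hypothesis f_monic : f \is monic.
Local Notation "p ^X" := (evp cst X p) (at level 2, format "p ^X").
Local Notation Z := (X^-1).
Local Notation W := (Y / X ^+ g.+1).
Local Notation hr := (revp g.+1 h).
Local Notation fr := (revp (2 * g).+2 f).
Local Notation Oinf := (chart_place iota cst Z W 0 0).

Let CMi := infinity_chart CM size_h size_f.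
Let X0 : X != 0 := chart_X_neq0 CM.

Lemma evp_at0 p : evp iota 0 p = iota p`_0.
Proof. by rewrite /evp horner_coef0 coef_map. Qed.

Let hr0 : evp iota 0 hr = 0.
Proof. by rewrite evp_at0 coef_revp /= subn0 nth_default // rmorph0. Qed.

Let fr0 : evp iota 0 fr = 0.
Proof. by rewrite evp_at0 coef_revp /= subn0 nth_default ?size_f // rmorph0. Qed.

Let fr1 : evp iota 0 fr^`() = 1.
Proof.
rewrite evp_at0 coef_deriv coef_revp /= subn1 /= mulr1n.
by have /monicP := f_monic; rewrite /lead_coef size_f /= => ->; rewrite rmorph1.
Qed.

Lemma on_infinity : 0 ^+ 2 + evp iota 0 hr * 0 = evp iota 0 fr.
Proof. by rewrite hr0 fr0 mul0r addr0 expr0n. Qed.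

Lemma nonsingular_infinity : ~ (2%:R * 0 + evp iota 0 hr = 0 /\
  evp iota 0 hr^`() * 0 - evp iota 0 fr^`() = 0).
Proof.
by case=> _ /eqP; rewrite fr1 mulr0 sub0r oppr_eq0 oner_eq0.
Qed.

Let POi := chart_placeP CMi on_infinity.

(** The origin of the chart at infinity is ramified, with minimal polynomial ['X] and lift
    [v = 0]. *)
Lemma W_uniformizer : punif Oinf W.
Proof.
have ma : evp iota 0 'X = 0 by rewrite evpX.
have mdvd (p : {poly F}) : evp iota 0 p = 0 -> 'X %| p.
  rewrite evp_at0 => /eqP; rewrite fmorph_eq0 => /eqP p0.
  by rewrite -['X]subr0 -polyC0 dvdp_XsubCl rootE horner_coef0 p0.
have ram : 2%:R * 0 + evp iota 0 hr = 0 by rewrite hr0 mulr0 addr0.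
have := ramified_uniformizer CMi on_infinity nonsingular_infinity ma mdvd ram
  (evp0 iota 0).
by rewrite evp0 subr0.
Qed.

(** [p(X)] is the reversal of [p] at [Z], a unit since its constant term is the leading coefficient
    of [p], divided by [Z^(deg p)]; and [Z] has order 2. *)
Lemma infinity_ord_evp p : p != 0 -> pord Oinf p^X (- (2 * (size p).-1)%:Z).
Proof.
move=> p0; pose n := (size p).-1.
have sp : size p = n.+1 by rewrite prednK // size_poly_gt0.
have op := chart_ord_evp CMi K_algebraic on_infinity nonsingular_infinity.
have ram : ram_index iota hr 0 0 = 2%N by rewrite /ram_index hr0 mulr0 addr0 eqxx.
have rp : evp iota 0 (revp n p) != 0.
  by rewrite evp_at0 coef_revp /= subn0 fmorph_eq0 -lead_coefE lead_coef_eq0.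
have r0 : revp n p != 0 by apply: contra_neq rp => ->; rewrite evp0.
have -> : p^X = evp cst Z (revp n p) / Z ^+ n.
  by rewrite evp_revp ?sp // exprVn invrK divfK // expf_neq0.
have := op _ r0; rewrite mupNroot // muln0 => o1.
have := op _ (negbT (polyX_eq0 F)); rewrite evpX ram map_polyX.
rewrite -['X]subr0 -polyC0 -['X - _]expr1 mup_XsubCX eqxx => o2.
have := pord_div POi o1 (pordX POi n o2).
by rewrite sub0r -/n; congr (pord _ _ (- _)); rewrite PoszM.
Qed.

Lemma infinity_ord_X : pord Oinf X (- 2).
Proof.
by have := infinity_ord_evp (negbT (polyX_eq0 F)); rewrite evpX size_polyX.
Qed.

Lemma infinity_ord_Y : pord Oinf Y (- (2 * g).+1%:Z).
Proof.
have := pordM POi (punif_ord POi W_uniformizer) (pordX POi g.+1 infinity_ord_X).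
rewrite divfK ?expf_neq0 //; suff -> : 1 + - 2 * g.+1%:Z = - (2 * g).+1%:Z by [].
lia.
Qed.

(** The pole orders [2 deg al] and [2 deg be + 2 g + 1] have different parities, so the terms cannot
    cancel, and a nonzero [be] forces a pole of order at least [2 g + 1]. *)
Lemma infinity_ord_lin al be k : pord Oinf (al^X + be^X * Y) k ->
  - (2 * g)%:Z <= k -> be = 0 /\ k = - (2 * (size al).-1)%:Z.
Proof.
move=> ok lek; have [be0|be0] := eqVneq be 0.
  split=> //; move: ok; rewrite be0 evp0 mul0r addr0 => ok.
  have al0 : al != 0 by apply: contra_neq (pord_neq0 POi ok) => ->; rewrite evp0.
  exact: (pord_fun POi ok (infinity_ord_evp al0)).
have ob := pordM POi (infinity_ord_evp be0) infinity_ord_Y.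
have [al0|al0] := eqVneq al 0.
  by move: ok; rewrite al0 evp0 add0r => /(pord_fun POi ob); lia.
have oa := infinity_ord_evp al0.
have [lt|gt|eq] := ltgtP (- (2 * (size al).-1)%:Z)
  (- (2 * (size be).-1)%:Z + - (2 * g).+1%:Z).
- by have := pord_fun POi ok (pordD POi oa ob lt); lia.
- by move: ok; rewrite addrC => /(pord_fun POi (pordD POi ob oa gt)); lia.
lia.
Qed.

Hypothesis nonsing : forall a b, b ^+ 2 + evp iota a h * b = evp iota a f ->
  ~ (2%:R * b + evp iota a h = 0 /\ evp iota a h^`() * b - evp iota a f^`() = 0).

(** Otherwise the characteristic is 2 and [h = 0]. Then [f'] has degree [2 g > 0], since [2 g + 1]
    is odd, and the point above any root of [f'] is singular. *)
Lemma two_Y_h_neq0 : (0 < g)%N -> 2%:R * Y + h^X != 0.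
Proof.
move=> g0; apply/eqP => e.
have [|h0 c2] := chart_indep CM (al := h) (be := 2%:R).
  by rewrite evp_nat addrC.
have c2F : 2%:R = 0 :> F.
  by move/(congr1 (fun p : {poly F} => p`_0)): c2; rewrite -polyC_natr coefC coef0.
have [a ra] : exists a, root (map_poly iota f^`()) a.
  apply/closed_rootP; rewrite size_map_poly gtn_eqF //.
  apply: leq_trans (_ : (2 * g).+1 <= _)%N; first by lia.
  rewrite ltnNge; apply/negP => /leq_sizeP /(_ _ (leqnn _)).
  rewrite coef_deriv; have /monicP := f_monic.
  rewrite /lead_coef size_f /= => ->; rewrite -addn1 natrD mulnC natrM c2F mulr0 add0r.
  by move/eqP; rewrite oner_eq0.
have [b eb] : exists b, b ^+ 2 + evp iota a h * b = evp iota a f.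
  have [b] := @solve_monicpoly K 2 (fun i => if i == 0%N then evp iota a f else 0) isT.
  rewrite big_ord_recl big_ord1 /= expr0 mulr1 mul0r addr0 => eb; exists b.
  by rewrite eb h0 evp0 mul0r addr0.
apply: (nonsing eb); rewrite h0 evp0 deriv0 evp0 mul0r sub0r addr0.
rewrite -(rmorph_nat iota) c2F rmorph0 mul0r; split=> //.
by rewrite [evp _ _ _](rootP ra) oppr0.
Qed.

(* [D e] is the quotient of [de] by the regular differential [dX / (2 Y + h)], *)
(* whose divisor is [(2 g - 2) Pinf].                                          *)
Lemma regular_differential : (0 < g)%N -> exists D : E -> E,
  [/\ derivation_over cst D, D X != 0,
      forall d, derivation_over cst d -> exists c, forall e, d e = c * D e,
      forall a b t, b ^+ 2 + evp iota a h * b = evp iota a f ->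
        punif (chart_place iota cst X Y a b) t ->
        pord (chart_place iota cst X Y a b) (D t)^-1 0 &
      forall t, punif Oinf t -> pord Oinf (D t)^-1 (2 * g.-1)%:Z].
Proof.
move=> g0; have nz := two_Y_h_neq0 g0.
have [D [DP DX DY]] := chart_derivation CM.
have [Di [DiP DiX DiY]] := chart_derivation CMi.
have nzi : 2%:R * W + evp cst Z hr = (2%:R * Y + h^X) / X ^+ g.+1.
  by rewrite evp_revp ?(leqW size_h) //; ring.
exists D; split=> //; first by rewrite DX.
- move=> d dP; exists (d X / (2%:R * Y + h^X)).
  exact: (derivation_proportional CM dP DP DX DY nz).
- move=> a b t on ut; have PO := chart_placeP CM on.
  have ud := chart_der_unit CM K_algebraic on (nonsing on) DP DX DY ut.
  by have := pordV PO (punit_ord ut ud); rewrite oppr0.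
move=> t ut.
have nzi0 : 2%:R * W + evp cst Z hr != 0 by rewrite nzi mulf_neq0 // invr_eq0 expf_neq0.
rewrite (derivation_proportional CMi DP DiP DiX DiY nzi0 t).
(* [D Z = - (2 Y + h) / X^2], while the denominator is [(2 Y + h) / X^(g + 1)]. Hence
   [D = - X^(g - 1) Di], and [X] has a double pole. *)
have -> : D Z / (2%:R * W + evp cst Z hr) = - X ^+ g.-1.
  rewrite nzi -[Z]mul1r (der_divE DP) // (der1 DP) DX.
  have -> : g.+1 = (2 + g.-1)%N by rewrite add2n prednK.
  by rewrite exprD; field; rewrite expf_neq0 // X0; apply: nz.
have ud := chart_der_unit CMi K_algebraic on_infinity nonsingular_infinity DiP DiX DiY ut.
have oX := pordX POi g.-1 infinity_ord_X.
have := pordV POi (pordM POi oX (punit_ord ut (punitN POi ud))).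
rewrite addr0 [- X ^+ _ * _]mulNr -mulrN.
suff -> : - (- 2 * g.-1%:Z) = (2 * g.-1)%:Z by []; lia.
Qed.

End Hyperelliptic.

(** * The function field and the divisors of the curve *)

Section LinearPoly.
Variable R : nzRingType.

Lemma lin_poly_eq0 (r0 r1 : R) : r0%:P + r1 *: 'X = 0 -> r0 = 0 /\ r1 = 0.
Proof.
move=> e; split; [have /polyP/(_ 0%N) := e | have /polyP/(_ 1%N) := e];
  by rewrite coefD coefC coefZ coefX coef0 ?mulr0 ?mulr1 ?addr0 ?add0r.
Qed.

Lemma lin_poly (p : {poly R}) : (size p < 3)%N -> p = (p`_0)%:P + p`_1 *: 'X.
Proof.
move=> sp; apply/polyP => -[|[|i]]; rewrite coefD coefC coefZ coefX /=;
  rewrite ?mulr0 ?mulr1 ?addr0 ?add0r //.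
by rewrite nth_default // -ltnS (leq_trans sp).
Qed.

Lemma size_lin_poly (r0 r1 : R) : (size (r0%:P + r1 *: 'X)%R < 3)%N.
Proof.
rewrite addrC -mul_polyC -cons_poly_def size_cons_poly; case: ifP => // _.
by rewrite !ltnS size_polyC_leq1.
Qed.

End LinearPoly.

(* [field] does not terminate on the concrete [function_field], hence this     *)
(* identity and the next one over an abstract field.                           *)
Lemma add_fractions (E : fieldType) (a0 b0 a1 b1 y : E) : b0 != 0 -> b1 != 0 ->
  a0 / b0 + a1 / b1 * y = (a0 * b1 + a1 * b0 * y) / (b0 * b1).
Proof. by move=> n0 n1; field; rewrite n0 n1. Qed.

Lemma cancel_factor (E : fieldType) (a b c d : E) : c != 0 -> d != 0 ->
  a * (c * b) / (c * d) * d = a * b.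
Proof. by move=> c0 d0; field; rewrite c0 d0. Qed.

Section Concrete.
Variables (F : finFieldType) (C : imaginary_model F).
Local Notation E := (function_field C).
Local Notation x := (xfun C).
Local Notation y := (yfun C).

Lemma ratfun_is_additive : zmod_morphism (@ratfun F C).
Proof. by move=> r s; rewrite /ratfun scalerBl. Qed.
Lemma ratfun_is_monoid : monoid_morphism (@ratfun F C).
Proof.
by split=> [|r s]; rewrite /ratfun ?scale1r // -scalerAl mul1r scalerA.
Qed.
HB.instance Definition _ :=
  GRing.isZmodMorphism.Build _ _ (@ratfun F C) ratfun_is_additive.
HB.instance Definition _ :=
  GRing.isMonoidMorphism.Build _ _ (@ratfun F C) ratfun_is_monoid.

Lemma cst_is_additive : zmod_morphism (@cst F C).
Proof. by move=> r s; rewrite /cst polyCB !rmorphB. Qed.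
Lemma cst_is_monoid : monoid_morphism (@cst F C).
Proof. by split=> [|r s]; rewrite /cst ?polyC1 ?polyCM ?rmorph1 // !rmorphM. Qed.
HB.instance Definition _ := GRing.isZmodMorphism.Build _ _ (@cst F C) cst_is_additive.
HB.instance Definition _ := GRing.isMonoidMorphism.Build _ _ (@cst F C) cst_is_monoid.

Lemma evp_xfun p : evp (@cst F C) x p = ratfun C (tofrac p).
Proof.
elim/poly_ind: p => [|p c IH]; first by rewrite evp0 !rmorph0.
by rewrite evpD evpM evpX evpC IH !(rmorphD, rmorphM).
Qed.

Lemma size_curve_poly : size (curve_poly C) = 3.
Proof.
rewrite /curve_poly -addrA size_polyDl size_polyXn //.
by rewrite -polyCN -cons_poly_def size_cons_poly; case: ifP => // _;
  rewrite !ltnS size_polyC_leq1.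
Qed.

Lemma in_qpoly_lin r0 r1 :
  ratfun C r0 + ratfun C r1 * y = in_qpoly (curve_poly C) (r0%:P + r1 *: 'X).
Proof.
rewrite in_qpolyD in_qpolyZ -alg_polyC in_qpolyZ in_qpoly1.
by congr (_ + _); rewrite /ratfun -scalerAl mul1r.
Qed.

Lemma ratfun_indep r0 r1 : ratfun C r0 + ratfun C r1 * y = 0 -> r0 = 0 /\ r1 = 0.
Proof.
rewrite in_qpoly_lin => /(congr1 (fun q : {poly %/ _} => q : {poly _})).
rewrite in_qpoly_small; last first.
  by rewrite (mk_monicE (curve_poly_irreducible C)) size_curve_poly size_lin_poly.
move=> e; have {e}e0 : r0%:P + r1 *: 'X = 0 :> {poly {fraction {poly F}}} by exact: e.
exact: lin_poly_eq0 e0.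
Qed.

Lemma ratfun_span e : exists r0 r1, e = ratfun C r0 + ratfun C r1 * y.
Proof.
exists (e : {poly _})`_0, (e : {poly _})`_1; rewrite in_qpoly_lin.
have szm : size (mk_monic (curve_poly C)) = 3.
  by rewrite (mk_monicE (curve_poly_irreducible C)) size_curve_poly.
have := size_mk_monic e; rewrite [X in (_ < X)%N]szm => se.
apply/val_inj; apply: etrans (lin_poly se) _; symmetry; apply: in_qpoly_small.
by rewrite [X in (_ < X)%N]szm size_lin_poly.
Qed.

Lemma affine_chart : chart_model (@cst F C) (hpol C) (fpol C) x y.
Proof.
split.
- apply/eqP; rewrite -subr_eq0 !evp_xfun; apply/eqP.
  have -> : y ^+ 2 + ratfun C (tofrac (hpol C)) * y - ratfun C (tofrac (fpol C))
    = in_qpoly (curve_poly C) (curve_poly C).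
    rewrite {2}/curve_poly raddfB raddfD /= mul_polyC in_qpolyZ.
    rewrite -alg_polyC in_qpolyZ in_qpoly1 expr2 in_qpolyM.
    by rewrite /ratfun -scalerAl mul1r.
  apply/val_inj; rewrite /= (mk_monicE (curve_poly_irreducible C)).
  by rewrite Pdiv.RingMonic.rmodpp // curve_poly_monic.
- move=> al be; rewrite !evp_xfun => /ratfun_indep [/eqP + /eqP].
  by rewrite !tofrac_eq0 => /eqP -> /eqP ->.
move=> e; have [r0 [r1 ->]] := ratfun_span e.
have [a0 [b0 [b00 ->]]] := fracE r0; have [a1 [b1 [b10 ->]]] := fracE r1.
exists (a0 * b1), (a1 * b0), (b0 * b1); split; first by rewrite mulf_neq0.
rewrite !evpM !evp_xfun !fmorph_div /=.
have n0 : ratfun C (tofrac b0) != 0 by rewrite fmorph_eq0 tofrac_eq0.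
have n1 : ratfun C (tofrac b1) != 0 by rewrite fmorph_eq0 tofrac_eq0.
exact: add_fractions.
Qed.

End Concrete.

(** * Orders at the points of the curve, canonical and Mumford divisors *)

Section Divisors.
Variables (F : finFieldType) (K : closedFieldType) (iota : {rmorphism F -> K}).
Variable C : imaginary_model F.
Hypothesis K_algebraic : integralRange iota.
Hypothesis C_nonsingular : nonsingular iota C.
Local Notation E := (function_field C).
Local Notation x := (xfun C).
Local Notation y := (yfun C).
Local Notation g := (genus C).
Local Notation point := (point iota C).
Local Notation evx := (evp (@cst F C) x).

Definition place_at (P : point) : E -> K -> Prop :=
  frac_place (chart_fun P) (chart_val P).

Lemma place_at_affine (Q : affine_point iota C) : place_at (Some Q) =
  chart_place iota (@cst F C) x y (val Q).1 (val Q).2.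
Proof. by []. Qed.

Lemma place_at_infinity : place_at None =
  chart_place iota (@cst F C) x^-1 (y / x ^+ g.+1) 0 0.
Proof. by []. Qed.

Lemma affine_point_eq (Q : affine_point iota C) :
  (val Q).2 ^+ 2 + evp iota (val Q).1 (hpol C) * (val Q).2 =
  evp iota (val Q).1 (fpol C).
Proof. exact/eqP/(valP Q). Qed.

Lemma affine_nonsingular a b :
  b ^+ 2 + evp iota a (hpol C) * b = evp iota a (fpol C) ->
  ~ (2%:R * b + evp iota a (hpol C) = 0 /\
     evp iota a (hpol C)^`() * b - evp iota a (fpol C)^`() = 0).
Proof.
move=> /eqP on; have onP : on_curve iota C (a, b) by [].
exact: C_nonsingular (exist _ (a, b) onP).
Qed.

Let CM := affine_chart C.
Let CMi := infinity_chart CM (size_hpol C) (size_fpol C).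
Let on_inf := on_infinity iota (size_hpol C) (size_fpol C).
Let ns_inf := nonsingular_infinity (iota := iota) (h := hpol C)
  (size_fpol C) (fpol_monic C).

Lemma place_atP P : place (place_at P).
Proof.
case: P => [Q|].
  by rewrite place_at_affine; exact: (chart_placeP CM (affine_point_eq Q)).
by rewrite place_at_infinity; exact: (chart_placeP CMi on_inf).
Qed.

Lemma place_at_ord_ex P e : e != 0 -> exists k, pord (place_at P) e k.
Proof.
case: P => [Q|] e0; [rewrite place_at_affine | rewrite place_at_infinity].
  exact: (chart_ord_ex CM K_algebraic (affine_point_eq Q)
    (affine_nonsingular (affine_point_eq Q)) e0).
exact: (chart_ord_ex CMi K_algebraic on_inf ns_inf e0).
Qed.

Lemma local_ringP P phi : local_ring P phi <-> integral (place_at P) phi.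
Proof.
split=> [[n [d [d0 e]]]|[w [n [d [d0 e _]]]]]; last by exists n, d.
by exists (chart_val P n / chart_val P d), n, d.
Qed.

Lemma local_maxP P phi : local_max P phi <-> place_at P phi 0.
Proof.
split=> [[n [d [n0 d0 e]]]|[n [d [d0 e /esym/eqP]]]].
  by exists n, d; rewrite n0 mul0r.
by rewrite mulf_eq0 invr_eq0 (negPf d0) orbF => /eqP n0; exists n, d.
Qed.

Lemma local_unitP P phi : local_unit P phi <-> punit (place_at P) phi.
Proof.
split=> [[n [d [n0 d0 e]]]|[w w0 [n [d [d0 e ew]]]]].
  exists (chart_val P n / chart_val P d); last by exists n, d.
  by rewrite mulf_neq0 // invr_eq0.
exists n, d; split=> //; apply: contra_neq w0 => n0.
by rewrite ew n0 mul0r.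
Qed.

Lemma uniformizerP P t : uniformizer P t <-> punif (place_at P) t.
Proof.
split=> -[t0 /local_maxP Ot It]; split=> // s /local_maxP /It /local_ringP //.
Qed.

Lemma has_ordP P phi k : has_ord P phi k <-> pord (place_at P) phi k.
Proof.
by split=> -[t /uniformizerP ut /local_unitP uphi]; exists t.
Qed.

Lemma place_at_unif P : exists t, punif (place_at P) t.
Proof. by have [k [t ut _]] := place_at_ord_ex P (oner_neq0 E); exists t. Qed.

Lemma coeff_Pinf_affine (Q : affine_point iota C) n :
  coeff (Some Q) (<< Pinf >> *+ n : {freeg point}) = 0.
Proof. by rewrite coeffMn coeffU mul1r /= mul0rn. Qed.

Lemma coeff_Pinf_infinity n : coeff None (<< Pinf >> *+ n : {freeg point}) = n%:Z.
Proof. by rewrite coeffMn coeffU mul1r /= natz. Qed.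

Local Notation K0 := (<< (Pinf : point) >> *+ (2 * g.-1)).

Lemma genus_gt0 : (0 < g)%N. Proof. exact: ltnW (genus_ge2 C). Qed.

Lemma regular_derivation : exists D : E -> E,
  [/\ derivation D, D x != 0,
      forall d, derivation d -> exists c, forall e, d e = c * D e &
      forall P t, punif (place_at P) t ->
        pord (place_at P) (D t)^-1 (coeff P K0)].
Proof.
have [D [DP Dx Dd Da Di]] := regular_differential CM K_algebraic (size_hpol C)
  (size_fpol C) (fpol_monic C) affine_nonsingular genus_gt0.
exists D; split=> // -[Q|] t; [rewrite coeff_Pinf_affine place_at_affine |
  rewrite coeff_Pinf_infinity place_at_infinity] => ut.
  exact: (Da _ _ _ (affine_point_eq Q) ut).
exact: (Di _ ut).
Qed.

Lemma canonical_Pinf : canonical_divisor K0.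
Proof.
have [D [DP Dx _ Do]] := regular_derivation.
exists D, (D x)^-1, x; rewrite mulVf //; split=> //; first exact: oner_neq0.
by move=> P t /uniformizerP ut; apply/has_ordP; rewrite mul1r; apply: Do.
Qed.

(** Every derivation is [c D], and [c] cancels in [phi * d psi / d t]. Comparison with [1 / D t], of
    divisor [K0], leaves the function [phi * D psi]. This reduces an arbitrary canonical divisor to
    [K0]. *)
Lemma canonical_ord W : @canonical_divisor F K iota C W ->
  exists eta, forall P, pord (place_at P) eta (coeff P W - coeff P K0).
Proof.
move=> [d [phi [psi [dP nz ordW]]]].
have [D [DP Dx Dd Do]] := regular_derivation.
have [c ec] := Dd d dP.
have c0 : c != 0.
  by apply: contra_neq nz => c0; rewrite ec c0 mul0r mulr0.
exists (phi * D psi) => P; have [t ut] := place_at_unif P.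
have PO := place_atP P.
have /has_ordP := ordW P t (iffRL (uniformizerP P t) ut).
rewrite !ec => oW; have oD := Do P t ut.
have Dt0 : D t != 0 by have := pord_neq0 PO oD; rewrite invr_eq0.
have := pord_div PO oW oD; rewrite invrK.
suff -> : phi * (c * D psi) / (c * D t) * D t = phi * D psi by [].
exact: cancel_factor.
Qed.

Lemma has_ell0 (G : {freeg point}) :
  has_ell G 0 <-> forall phi, RR_space G phi -> phi = 0.
Proof.
split=> [[e [_ He]] phi /He [c ->]|He]; first by rewrite big_ord0.
exists (fun _ => 0); split=> [c _ []//|phi].
split=> [/He ->|[c ->]]; first by exists (fun _ => 0); rewrite big_ord0.
by left; rewrite big_ord0.
Qed.

Lemma coeff_mumford_infinity u v : coeff None (mumford_div iota C u v) = 0.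
Proof.
rewrite /mumford_div raddf_sum big1 // => a _; rewrite /affine_div /=.
by case: insub => [R|]; [rewrite coeffU mul1r | rewrite coeff0].
Qed.

Lemma coeff_mumford_affine u v (Q : affine_point iota C) : mumford_pair C u v ->
  coeff (Some Q) (mumford_div iota C u v) =
  if (val Q).2 == evp iota (val Q).1 v then (mup (val Q).1 (map_poly iota u))%:Z
  else 0.
Proof.
move=> muv; have [u_mon _ _] := muv.
have eu : map_poly iota u = \prod_(a <- geom_roots iota u) ('X - a%:P).
  rewrite /geom_roots; case: closed_field_poly_normal => r /= {1}->.
  by rewrite lead_coef_map (monicP u_mon) rmorph1 scale1r.
rewrite /mumford_div raddf_sum eu mu_prod_XsubC.
(* The induction runs over lists of roots of [u], so that every point met is on the curve and
   [affine_div] never takes its default value 0. *)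
have : {subset geom_roots iota u <= geom_roots iota u} by [].
move: {-2}(geom_roots iota u) => s.
elim: s => [|a s IH] sub; first by rewrite big_nil /=; case: ifP.
rewrite big_cons IH => [|b bs]; last by apply: sub; rewrite inE bs orbT.
have on : on_curve iota C (a, evp iota a v).
  by apply: (mumford_on_curve muv); apply: sub; rewrite inE eqxx.
rewrite /affine_div insubT /= coeffU mul1r.
have -> : (Some (exist _ (a, evp iota a v) on) == Some Q) =
   (a == (val Q).1) && ((val Q).2 == evp iota (val Q).1 v).
  rewrite (inj_eq Some_inj) -val_eqE /= -pair_eqE /=.
  by case: eqVneq => //= ->; rewrite eq_sym.
by case: (_ == evp _ _ _); rewrite ?andbT ?andbF ?addr0 // natz PoszD.
Qed.

End Divisors.

(** * The Riemann-Roch space of [W - A] *)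

Section NonSpecial.
Variables (F : finFieldType) (K : closedFieldType) (iota : {rmorphism F -> K}).
Variable C : imaginary_model F.
Hypothesis K_algebraic : integralRange iota.
Hypothesis C_nonsingular : nonsingular iota C.
Local Notation E := (function_field C).
Local Notation x := (xfun C).
Local Notation y := (yfun C).
Local Notation g := (genus C).
Local Notation evx := (evp (@cst F C) x).
Local Notation PO := (place_atP (iota := iota) (C := C)).
Variables (A : {freeg (point iota C)}) (u v : {poly F}).
Hypothesis uv : reduced_mumford_pair C u v.
Hypothesis classA : lin_equiv (A - << Pinf >> *+ g)
  (mumford_div iota C u v - << Pinf >> *+ pdeg u).

Let u_neq0 : u != 0. Proof. by case: uv => -[/monic_neq0]. Qed.

Lemma affine_ord_evp (Q : affine_point iota C) p : p != 0 ->
  pord (place_at (Some Q)) (evx p)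
    (ram_index iota (hpol C) (val Q).1 (val Q).2 * mup (val Q).1 (map_poly iota p))%N.
Proof.
move=> p0; rewrite place_at_affine.
exact: (chart_ord_evp (affine_chart C) K_algebraic (affine_point_eq Q)
  (affine_nonsingular C_nonsingular (affine_point_eq Q)) p0).
Qed.

Lemma place_at_infinity_evp p : p != 0 ->
  pord (place_at (None : point iota C)) (evx p) (- (2 * pdeg p)%:Z).
Proof.
move=> p0; rewrite place_at_infinity.
exact: (infinity_ord_evp (affine_chart C) K_algebraic (size_hpol C)
  (size_fpol C) (fpol_monic C) p0).
Qed.

Lemma special_of_small_degree : (pdeg u < g.-1)%N -> ~ non_special A.
Proof.
move=> lt_ug [W canW /has_ell0 L0].
have [eta oeta] := canonical_ord K_algebraic C_nonsingular canW.
have [phi0 ophi] := classA.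
have {}ophi P := iffLR (has_ordP P _ _) (ophi P).
have ord_u P : exists2 k, pord (place_at P) (evx u) k &
    coeff P (mumford_div iota C u v) + coeff P (<< Pinf >> *+ g)
      - coeff P (<< Pinf >> *+ pdeg u)
      <= k + coeff P (<< Pinf >> *+ (2 * g.-1)).
  case: P => [Q|].
    rewrite (coeff_mumford_affine Q (proj1 uv)) !coeff_Pinf_affine.
    eexists; first exact: affine_ord_evp.
    by rewrite /ram_index; case: ifP => _; case: ifP => _; lia.
  rewrite coeff_mumford_infinity !coeff_Pinf_infinity.
  eexists; first exact: place_at_infinity_evp.
  by move: lt_ug; move: (pdeg u); lia.
have [k0 ou0 _] := ord_u None.
(* This nonzero function is the element of [L(W - A)] corresponding to [psi = u]; the bound at
   [Pinf] is [2 d <= g - 2 + d]. *)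
suff : evx u * (phi0 / eta) = 0.
  move=> e; have := pord_neq0 (PO None)
    (pordM (PO None) ou0 (pord_div (PO None) (ophi None) (oeta None))).
  by rewrite e eqxx.
apply: L0; right=> P; have [k ou le_k] := ord_u P.
eexists.
  by apply/has_ordP; apply: (pordM (PO P) ou (pord_div (PO P) (ophi P) (oeta P))).
by move: le_k; rewrite !coeffB; lia.
Qed.

Lemma regular_at_affine psi :
  (forall Q : affine_point iota C, integral (place_at (Some Q)) psi) ->
  exists al be, psi = evx al + evx be * y.
Proof.
move=> reg; apply: (regular_everywhere (affine_chart C) K_algebraic
  (affine_nonsingular C_nonsingular)) => a b on.
have onP : on_curve iota C (a, b) by apply/eqP.
by have := reg (exist _ (a, b) onP); rewrite place_at_affine.
Qed.

(** At an unramified point the order of [al] is its multiplicity at [a]. At a ramified one it is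
    twice that, but there [u] has at most a simple root ([ramified_mup]), so a positive order
    suffices. *)
Lemma mumford_dvdp al : al != 0 ->
  (forall Q : affine_point iota C, exists2 k, pord (place_at (Some Q)) (evx al) k &
    coeff (Some Q) (mumford_div iota C u v) <= k) -> u %| al.
Proof.
move=> al0 vanish; apply: (dvdp_mup u_neq0 al0) => a.
suff le_mup : (mup a (map_poly iota u) <= mup a (map_poly iota al))%N by exact: le_mup.
have [->//|mu0] := posnP (mup a (map_poly iota u)).
have [_ _ uvf] := proj1 uv.
have ua : evp iota a u = 0.
  by apply/rootP; rewrite -dvdp_XsubCl XsubC_dvd // map_poly_eq0.
have on : on_curve iota C (a, evp iota a v).
  rewrite /on_curve /= -subr_eq0; have /dvdpP [q /(congr1 (evp iota a))] := uvf.
  by rewrite !(evpD, evpN, evpM, evpXn) ua mulr0 => /eqP.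
have [k ok] := vanish (exist _ (a, evp iota a v) on).
rewrite (coeff_mumford_affine _ (proj1 uv)) eqxx => le_k.
have {}le_k : (mup a (map_poly iota u))%:Z <= k by exact: le_k.
have ek : k = (ram_index iota (hpol C) a (evp iota a v)
  * mup a (map_poly iota al))%N := pord_fun (PO _) ok (affine_ord_evp _ al0).
move: le_k; rewrite {}ek /ram_index; case: eqVneq => [ram|_]; last lia.
suff : (mup a (map_poly iota u) <= 1)%N by lia.
apply: (ramified_mup u_neq0 uvf) ram.
exact: (affine_nonsingular C_nonsingular (eqP on)).
Qed.

Lemma non_special_of_large_degree : (g.-1 <= pdeg u)%N -> non_special A.
Proof.
move=> le_gu; exists (<< Pinf >> *+ (2 * g.-1)).
  exact: canonical_Pinf K_algebraic C_nonsingular.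
apply/has_ell0 => phi [//|ordphi].
have [phi0 ophi] := classA.
have {}ophi P := iffLR (has_ordP P _ _) (ophi P).
(* Dividing by [phi0] trades [A] for [D_u + (g - d) Pinf] in the bound on the divisor of [phi]. *)
have ord_psi P : exists2 k, pord (place_at P) (phi / phi0) k &
    coeff P (mumford_div iota C u v) + coeff P (<< Pinf >> *+ g)
      - coeff P (<< Pinf >> *+ pdeg u) - coeff P (<< Pinf >> *+ (2 * g.-1)) <= k.
  have [k /has_ordP ok le_k] := ordphi P.
  eexists; first exact: (pord_div (PO P) ok (ophi P)).
  by move: le_k; rewrite !coeffB; lia.
have [|al [be epsi]] := regular_at_affine (psi := phi / phi0).
  move=> Q; have [k ok le_k] := ord_psi (Some Q).
  apply: (pord_ge0 (PO _) ok); apply: le_trans le_k.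
  rewrite (coeff_mumford_affine _ (proj1 uv)) !coeff_Pinf_affine !(subr0, addr0).
  by case: ifP.
have [k ok] := ord_psi None.
rewrite coeff_mumford_infinity !coeff_Pinf_infinity add0r => le_k.
have le_ug := proj2 uv; have g2 := genus_ge2 C.
(* The pole at infinity has order at most [g - 2 + d <= 2 g - 2], because the pair is reduced. *)
have [be0 ek] : be = 0 /\ k = - (2 * (size al).-1)%:Z.
  move: ok; rewrite epsi place_at_infinity => ok.
  apply: (infinity_ord_lin (affine_chart C) K_algebraic (size_hpol C)
    (size_fpol C) (fpol_monic C) ok).
  by lia.
have {}epsi : phi / phi0 = evx al by rewrite epsi be0 evp0 mul0r addr0.
have al0 : al != 0.
  by apply: contra_neq (pord_neq0 (PO _) ok) => e; rewrite epsi e evp0.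
(* Divisibility gives [d <= deg al], while the pole bound gives [2 deg al <= g - 2 + d]; together
   they contradict [d >= g - 1]. *)
have /(dvdp_leq al0) : u %| al.
  apply: mumford_dvdp => // Q; have [l] := ord_psi (Some Q).
  rewrite epsi !coeff_Pinf_affine !(subr0, addr0) => ol le_l.
  by exists l.
have := u_neq0; rewrite -size_poly_gt0; move: le_k ek le_gu le_ug g2.
by rewrite /pdeg; move: (size u) (size al); lia.
Qed.

End NonSpecial.

Theorem theorem1 (F : finFieldType) (K : closedFieldType)
    (iota : {rmorphism F -> K}) (C : imaginary_model F)
    (K_algebraic : integralRange iota)
    (C_nonsingular : nonsingular iota C)
    (A : {freeg (point iota C)}) (A_rational : rational_divisor A)
    (A_deg : deg A = (genus C)%:Z)
    (uA vA : {poly F}) (uvA : reduced_mumford_pair C uA vA)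
    (classA : lin_equiv (A - << Pinf >> *+ genus C)
                        (mumford_div iota C uA vA - << Pinf >> *+ pdeg uA)) :
  (non_special A <-> pdeg uA = (genus C).-1 \/ pdeg uA = genus C) /\
  (non_special A <-> ((genus C).-1 <= pdeg uA)%N).
Proof.
have ge_iff : non_special A <-> ((genus C).-1 <= pdeg uA)%N.
  split=> [ns|]; last exact: non_special_of_large_degree uvA classA.
  rewrite leqNgt; apply/negP => lt_ug.
  exact: (special_of_small_degree K_algebraic C_nonsingular uvA classA lt_ug ns).
split=> //; apply: iff_trans ge_iff _.
by have [_ le_ug] := uvA; have := genus_ge2 C; lia.
Qed.
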